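(* Assume $r>I=1$, so that $Z^{(1)},\dots,Z^{(r)}$ are $r$ independent random walks in the same recurrent random environment $\omega$. For $\mathsf P$-almost every $\omega$, there exists $c(\omega)>0$ such that, for every $(y_1,\dots,y_r)\in(2\mathbb Z)^r\cup(2\mathbb Z+1)^r$, $$\limsup_{N\to+\infty}\frac1{\log N}\sum_{n=1}^N\frac1n\sum_{k\in\mathbb Z}\prod_{j=1}^rP_\omega^{y_j}\big[Z_n^{(j)}=k\big]\ \ge\ c(\omega).$$
   Context: Setting. On a probability space $(\Omega,\mathcal F,\mathsf P)$ (expectation $\mathsf E$), $\omega=(\omega_x)_{x\in\mathbb Z}$ is a collection of i.i.d. random variables with values in $(0,1)$ (the common environment of all the walks). With $\rho_k=(1-\omega_k)/\omega_k$, assume there is $\varepsilon_0\in(0,1/2)$ such that $\mathsf P[\omega_0\in[\varepsilon_0,1-\varepsilon_0]]=1$, $\mathsf E[\log\rho_0]=0$ and $\mathsf E[(\log\rho_0)^2]>0$. For fixed $\omega$, $P_\omega^{y}[Z^{(j)}\in\cdot]$ denotes the law of the Markov chain $Z^{(j)}$ on $\mathbb Z$ started at $y\in\mathbb Z$ with transition probabilities $P_\omega^{y}[Z^{(j)}_{n+1}=z+1\mid Z^{(j)}_n=z]=\omega_z=1-P_\omega^{y}[Z^{(j)}_{n+1}=z-1\mid Z^{(j)}_n=z]$. *)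

(* Defs.v *)
From HB Require Import structures.
From mathcomp Require Export all_boot all_order all_algebra finmap.
From mathcomp Require Export all_classical all_reals all_analysis.
Set Implicit Arguments.
Unset Strict Implicit.
Unset Printing Implicit Defensive.
Import Order.TTheory GRing.Theory Num.Theory.
Import numFieldNormedType.Exports.

Local Open Scope classical_set_scope.
Local Open Scope ring_scope.

HB.instance Definition _ := isPointed.Build int 0.

HB.instance Definition _ := @isMeasurable.Build default_measure_display int
  discrete_measurable discrete_measurable0
  discrete_measurableC discrete_measurableU.

Definition mutually_independent d (T : measurableType d) (R : realType)
    (P : probability T R) (I : choiceType) (G : I -> set (set T)) : Prop :=
  forall (J : {fset I}) (A : I -> set T),
    (forall i, i \in J -> G i (A i)) ->
    P (\bigcap_(i in [set` J]) A i) = (\prod_(i <- J) P (A i))%E.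

Definition sigma_gen_rv d (T : measurableType d) d' (S : measurableType d')
    (X : T -> S) : set (set T) :=
  preimage_set_system setT X measurable.

Definition sigma_gen_process d (T : measurableType d) d' (S : measurableType d')
    (X : nat -> T -> S) : set (set T) :=
  <<s \bigcup_n sigma_gen_rv (X n) >>.

Definition identically_distributed d (T : measurableType d) d'
    (S : measurableType d') (R : realType) (P : probability T R)
    (X Y : {RV P >-> S}) : Prop :=
  forall A, measurable A -> distribution P X A = distribution P Y A.

Definition iid_environment d (T : measurableType d) (R : realType)
    (P : probability T R) (omega : int -> {RV P >-> R}) : Prop :=
  [/\ forall x t, 0 < omega x t < 1,
      mutually_independent P (fun x => sigma_gen_rv (omega x)) &
      forall x, identically_distributed (omega x) (omega 0)].

Definition rho (R : realType) (a : R) : R := (1 - a) / a.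

Definition transition (R : realType) (e : int -> R) (z z' : int) : R :=
  if z' == z + 1 then e z else if z' == z - 1 then 1 - e z else 0.

(* The Markov property is written in product form, so that it makes sense for
   pasts of probability zero. *)
Definition walk_in_environment d (T : measurableType d) (R : realType)
    (Q : probability T R) (e : int -> R) (y : int)
    (Z : nat -> {RV Q >-> int}) : Prop :=
  Q [set t | Z 0%N t = y] = 1%E /\
  forall (n : nat) (z : nat -> int),
    Q [set t | forall i, (i <= n.+1)%N -> Z i t = z i] =
    (Q [set t | forall i, (i <= n)%N -> Z i t = z i] *
      (transition e (z n) (z n.+1))%:E)%E.

Definition independent_walks d (T : measurableType d) (R : realType)
    (Q : probability T R) (e : int -> R) (r : nat) (y : 'I_r -> int)
    (Z : 'I_r -> nat -> {RV Q >-> int}) : Prop :=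
  (forall j, walk_in_environment e (y j) (Z j)) /\
  mutually_independent Q (fun j => sigma_gen_process (fun n => Z j n : T -> int)).

(* Main.v *)
(* Idea.  In reversible form the walk has conductances [exp(-V)], where the
   potential [V] is a random walk with the centred increments [ln rho].

   For a fixed environment, let [b] be the bottom of a valley whose walls have
   height [10h] while the points between the starting points and [b] have height
   at most about [5h].  By reversibility and Cauchy-Schwarz the return
   probability to [b] at even times up to [exp(9h)] is at least a constant,
   provided that the sum of [exp(-(V - V b))] over the valley is bounded.  The
   energy of [x |-> p_n(x, b)] is at most of order [1/n], because return
   probabilities at even times are convex in time; hence after time [exp(6h)]
   the probability of being at [b] hardly depends on the starting point.  All
   walks meet at [b] (or at [b + 1], by parity) with probability bounded below
   for all times between [exp(6h)] and [exp(9h)], a positive fraction of the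
   logarithmic scale.  (All these times carry a common factor [exp(-V b)].)

   Such valleys occur at infinitely many scales: on disjoint blocks of sites,
   growing fast enough to make everything explored earlier negligible, each
   block is good with conditional probability at least [1/22 ^ 2].  These
   probabilities come from (super)martingales of the potential killed outside
   the valley: a linear one for the shape, the square for the duration, and one
   involving [exp(-(V - min V)/2)] for the sum of [exp(-(V - min V))]. *)

From HB Require Import structures.
Require Import Defs.
From mathcomp Require Import measurable_realfun ring lra zify.
Set Implicit Arguments.
Unset Strict Implicit.
Unset Printing Implicit Defensive.
Import Order.TTheory GRing.Theory Num.Theory.
Import numFieldNormedType.Exports.

Local Open Scope classical_set_scope.
Local Open Scope ring_scope.

(** * Independence from the explored part of the environment *)

Section past.
Context d (T : measurableType d) (R : realType) (P : probability T R)
  (omega : int -> {RV P >-> R}).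

Definition past_gen (D : set int) : set (set T) :=
  \bigcup_(j in D) sigma_gen_rv (omega j).

(** A copy of [T] carrying the sigma-algebra of the sites in [D], so that measurability with respect
    to the past is [measurable_fun] on this type. *)
Definition past (D : set int) := g_sigma_algebraType (past_gen D).

Lemma past_measurable D (A : set T) : <<s past_gen D >> A -> measurable A.
Proof.
suff: <<s past_gen D >> `<=` @measurable _ T by apply.
apply: (smallest_sub (sigma_algebra_measurable T)).
move=> _ [j _ [B mB <-]]; rewrite setTI; exact: (measurable_funPTI (omega j)).
Qed.

Definition cylinders (D : set int) : set (set T) :=
  [set A | exists (J : {fset int}) (B : int -> set R),
    (forall i, i \in J -> D i /\ measurable (B i)) /\
    A = \bigcap_(i in [set` J]) (omega i @^-1` B i)].

Lemma cylindersI D : setI_closed (cylinders D).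
Proof.
move=> _ _ [J [B [JB ->]]] [K [E [KE ->]]].
(* A site occurring in only one of the two cylinders gets the constraint [setT] from the other. *)
exists (J `|` K)%fset.
exists (fun i => (if i \in J then B i else setT) `&` (if i \in K then E i else setT)).
split.
  move=> i; rewrite in_fsetU => iJK; split.
    by case/orP: iJK => [/JB[]|/KE[]].
  apply: measurableI; case: ifPn => // h; first by have [] := JB _ h.
  by have [] := KE _ h.
apply/seteqP; split => [w [wJ wK] i /=|w h]; last split => i /= iX.
- rewrite in_fsetU => _; split.
    by case: ifPn => // h; exact: (wJ i h).
  by case: ifPn => // h; exact: (wK i h).
- have /= := h i; rewrite in_fsetU iX => /(_ isT) []//.
- by have /= := h i; rewrite in_fsetU iX orbT => /(_ isT) [].
Qed.

Lemma past_cylinders D : <<s past_gen D >> = <<s cylinders D >>.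
Proof.
apply/seteqP; split; apply: (smallest_sub (smallest_sigma_algebra _ _)).
- move=> _ [j Dj [B mB <-]]; apply: sub_sigma_algebra.
  exists [fset j]%fset, (fun=> B); split.
    by move=> i; rewrite inE => /eqP ->.
  rewrite setTI; apply/seteqP; split => [w h i /=|w h /=].
    by rewrite inE => /eqP ->.
  by apply: (h j); rewrite /= inE.
- move=> _ [J [B [JB ->]]].
  have -> : \bigcap_(i in [set` J]) (omega i @^-1` B i) =
      \big[setI/setT]_(i <- J) (omega i @^-1` B i).
    by rewrite bigcap_fset.
  rewrite big_seq.
  apply: (@big_ind _ (fun A => @measurable _ (past D) A)).
  + exact: measurableT.
  + exact: measurableI.
  + move=> i /JB [Di mB]; apply: sub_sigma_algebra; exists i => //.
    by exists (B i) => //; rewrite setTI.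
Qed.

Hypothesis omega_indep :
  mutually_independent P (fun x => sigma_gen_rv (omega x)).

(** Mutual independence speaks of finitely many sites, that is of cylinders. These form a pi-system
    generating the past, and the product rule is stable under complements and disjoint unions, so
    Dynkin induction applies. *)
Lemma past_indep D (A : set T) j (B : set R) : ~ D j ->
  <<s past_gen D >> A -> measurable B ->
  P (A `&` omega j @^-1` B) = (P A * P (omega j @^-1` B))%E.
Proof.
move=> nDj sA mB.
have mjB : measurable (omega j @^-1` B) by exact: measurable_funPTI.
move: A sA; rewrite past_cylinders.
have mp A : @measurable _ (past D) A -> @measurable _ T A by exact: past_measurable.
pose Q (A : set T) := P (A `&` omega j @^-1` B) = (P A * P (omega j @^-1` B))%E.
have QC (S : set T) : measurable S -> Q S -> Q (~` S).
  rewrite /Q => mS hS.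
  have -> : ~` S `&` omega j @^-1` B = omega j @^-1` B `\` (S `&` omega j @^-1` B).
    apply/seteqP; split => w /=; first by move=> [? ?]; split => // -[].
    by move=> [? h]; split => // ?; apply: h.
  rewrite measureD//; last 2 first.
    exact: measurableI.
    by rewrite (le_lt_trans (probability_le1 _ _))// ?ltry.
  rewrite setICA setIid probability_setC//.
  transitivity (P (omega j @^-1` B) - P S * P (omega j @^-1` B))%E.
    by congr (_ - _)%E; exact: hS.
  rewrite muleBl ?mul1e//; exact: fin_num_measure.
have QU (F : nat -> set T) : (forall n, measurable (F n)) ->
    trivIset setT F -> (forall n, Q (F n)) -> Q (\bigcup_k F k).
  rewrite /Q => mF tF hF.
  rewrite setI_bigcupl measure_bigcup//=; last 2 first.
    by move=> n _; exact: measurableI.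
    apply/trivIsetP => m n _ _ mn; move/trivIsetP: tF => /(_ m n I I mn) mn0.
    apply/seteqP; split => // w [[? _] [? _]]; rewrite -mn0; by split.
  rewrite measure_bigcup//= muleC.
  have <- : (fine (P (omega j @^-1` B)))%:E = P (omega j @^-1` B).
    by rewrite fineK//; exact: fin_num_measure.
  rewrite -nneseriesZl//; apply: eq_eseriesr => n _; rewrite hF muleC fineK//.
  exact: fin_num_measure.
apply: (@dynkin_induction _ (past D) (cylinders D)
  Q).
- exact: past_cylinders.
- exact: cylindersI.
- by rewrite /Q setTI probability_setT mul1e.
- move=> _ [J [E [JE ->]]]; rewrite /Q.
  have nJ : j \notin J by apply/negP => /JE[].
  (* Adding [j] to the finite index set turns the intersection into a single cylinder. *)
  pose E' i := if i == j then B else E i.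
  have h1 := @omega_indep J (fun i => omega i @^-1` E i).
  have h2 := @omega_indep (j |` J)%fset (fun i => omega i @^-1` E' i).
  rewrite h1; last first.
    by move=> i /JE [_ mE]; exists (E i) => //; rewrite setTI.
  have -> : \bigcap_(i in [set` J]) (omega i @^-1` E i) `&` (omega j @^-1` B)
     = \bigcap_(i in [set` (j |` J)%fset]) (omega i @^-1` E' i).
    apply/seteqP; split => [w [h hB] i /=|w h].
      rewrite in_fset1U /E' => /orP[/eqP ->|iJ]; first by rewrite eqxx.
      have -> : (i == j) = false by apply/eqP => e; rewrite -e iJ in nJ.
      exact: h.
    split => [i /= iJ|].
      have := h i; rewrite /= in_fset1U iJ orbT /E' => /(_ isT).
      by have -> : (i == j) = false by apply/eqP => e; rewrite -e iJ in nJ.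
    by have := h j; rewrite /= in_fset1U eqxx /E' => /(_ isT); rewrite eqxx.
  rewrite h2; last first.
    move=> i; rewrite in_fset1U => iJ; exists (E' i); last by rewrite setTI.
    rewrite /E'; case: eqP => // ij.
    by case/orP: iJ => [/eqP//|/JE[]].
  rewrite big_fsetU1//= {1}/E' eqxx muleC; congr (_ * _)%E.
  rewrite big_seq [RHS]big_seq; apply: eq_bigr => i iJ.
  rewrite /E'; have -> // : (i == j) = false by apply/eqP => e; rewrite -e iJ in nJ.
- by move=> S mS; apply: QC; exact: mp.
- by move=> F mF; apply: QU => n; exact: mp.
Qed.

End past.

(** * Bounded functions of the explored environment *)

Section bpast.
Context d (T : measurableType d) (R : realType) (P : probability T R)
  (omega : int -> {RV P >-> R}).
Implicit Types (D : set int) (f g : T -> R).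

Definition mpast D (b : T -> bool) :=
  measurable_fun [set: past omega D] (b : past omega D -> bool).

(** Boundedness gives integrability and is preserved by every operation of the exploration, products
    and exponentials included. *)
Definition bpast D f :=
  measurable_fun [set: past omega D] (f : past omega D -> R) /\
  exists M, forall w, `|f w| <= M.

Lemma bpast_cst D (c : R) : bpast D (fun=> c).
Proof. by split; [exact: measurable_cst|exists `|c|]. Qed.

Lemma bpastD D f g : bpast D f -> bpast D g -> bpast D (fun w => f w + g w).
Proof.
move=> [mf [M fM]] [mg [N gN]]; split; first exact: measurable_funD.
by exists (M + N) => w; rewrite (le_trans (ler_normD _ _))// lerD.
Qed.

Lemma bpastM D f g : bpast D f -> bpast D g -> bpast D (fun w => f w * g w).
Proof.
move=> [mf [M fM]] [mg [N gN]]; split; first exact: measurable_funM.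
by exists (M * N) => w; rewrite normrM ler_pM.
Qed.

Lemma bpastB D f g : bpast D f -> bpast D g -> bpast D (fun w => f w - g w).
Proof.
move=> [mf [M fM]] [mg [N gN]]; split; first exact: measurable_funB.
by exists (M + N) => w; rewrite (le_trans (ler_normB _ _))// lerD.
Qed.

Lemma bpast_max D f g : bpast D f -> bpast D g ->
  bpast D (fun w => Num.max (f w) (g w)).
Proof.
move=> [mf [M fM]] [mg [N gN]]; split; first exact: measurable_maxr.
exists (M + N) => w; rewrite /Num.max; case: ifP => _.
  by rewrite (le_trans (gN w))// lerDr (le_trans _ (fM w)).
by rewrite (le_trans (fM w))// lerDl (le_trans _ (gN w)).
Qed.

Lemma bpast_min D f g : bpast D f -> bpast D g ->
  bpast D (fun w => Num.min (f w) (g w)).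
Proof.
move=> [mf [M fM]] [mg [N gN]]; split; first exact: measurable_minr.
exists (M + N) => w; rewrite /Num.min; case: ifP => _.
  by rewrite (le_trans (fM w))// lerDl (le_trans _ (gN w)).
by rewrite (le_trans (gN w))// lerDr (le_trans _ (fM w)).
Qed.

Lemma bpast_expR D f : bpast D f -> bpast D (fun w => expR (f w)).
Proof.
move=> [mf [M fM]]; split; first exact: measurableT_comp.
by exists (expR M) => w; rewrite ger0_norm ?expR_ge0// ler_expR (le_trans (ler_norm _)).
Qed.

Lemma mpast_le D f g : bpast D f -> bpast D g -> mpast D (fun w => f w <= g w).
Proof. by move=> [mf _] [mg _]; exact: measurable_fun_ler. Qed.

Lemma mpast_and D b1 b2 : mpast D b1 -> mpast D b2 ->
  mpast D (fun w => b1 w && b2 w).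
Proof. exact: measurable_and. Qed.

Lemma mpast_or D b1 b2 : mpast D b1 -> mpast D b2 ->
  mpast D (fun w => b1 w || b2 w).
Proof. exact: measurable_or. Qed.

Lemma bpast_if D b f g : mpast D b -> bpast D f -> bpast D g ->
  bpast D (fun w => if b w then f w else g w).
Proof.
move=> mb [mf [M fM]] [mg [N gN]]; split; first exact: measurable_fun_ifT.
exists (M + N) => w; case: ifP => _.
  by rewrite (le_trans (fM w))// lerDl (le_trans _ (gN w)).
by rewrite (le_trans (gN w))// lerDr (le_trans _ (fM w)).
Qed.

Lemma mpast_if D b b1 b2 : mpast D b -> mpast D b1 -> mpast D b2 ->
  mpast D (fun w => if b w then b1 w else b2 w).
Proof. by move=> mb m1 m2; exact: measurable_fun_ifT. Qed.

Lemma past_sub D D' (A : set T) : D `<=` D' ->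
  @measurable _ (past omega D) A -> @measurable _ (past omega D') A.
Proof.
move=> DD'.
have h : past_gen omega D `<=` past_gen omega D'.
  by move=> B [j Dj h]; exists j => //; exact: DD'.
exact: (sub_sigma_algebra2 h).
Qed.

Lemma bpast_sub D D' f : D `<=` D' -> bpast D f -> bpast D' f.
Proof.
move=> DD' [mf bf]; split => // _ B mB.
exact: past_sub DD' (mf measurableT _ mB).
Qed.

Lemma mpast_sub D D' b : D `<=` D' -> mpast D b -> mpast D' b.
Proof. by move=> DD' mb _ B mB; exact: past_sub DD' (mb measurableT _ mB). Qed.

Lemma bpast_omega D j (phi : R -> R) (M : R) : D j ->
  measurable_fun setT phi -> (forall x, `|phi x| <= M) ->
  bpast D (fun w => phi (omega j w)).
Proof.
move=> Dj mphi bphi; split; last by exists M.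
apply: (@measurableT_comp _ _ _ _ _ _ phi) => //.
move=> _ B mB; apply: sub_sigma_algebra; exists j => //.
by exists B.
Qed.

Lemma bpast_measurable D f : bpast D f -> measurable_fun [set: T] f.
Proof. by move=> [mf _] _ B mB; exact: past_measurable (mf measurableT _ mB). Qed.

Lemma bpast_integrable D f : bpast D f -> P.-integrable setT (EFin \o f).
Proof.
move=> bf; have mf := bpast_measurable bf; case: bf => _ [M fM].
apply: measurable_bounded_integrable => //.
  by rewrite (le_lt_trans (probability_le1 _ _))// ?ltry.
exists M; split; first exact: num_real.
move=> x Mx w _ /=.
by apply: le_trans (fM w) _; exact: ltW.
Qed.

Definition Ex f : R := \int[P]_w f w.

Lemma Ex_cst c : Ex (fun=> c) = c.
Proof.
by rewrite /Ex Rintegral_cst//= probability_setT mulr1.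
Qed.

Lemma ExD D f g : bpast D f -> bpast D g -> Ex (fun w => f w + g w) = Ex f + Ex g.
Proof. by move=> /bpast_integrable ? /bpast_integrable ?; exact: RintegralD. Qed.

Lemma ExB D f g : bpast D f -> bpast D g -> Ex (fun w => f w - g w) = Ex f - Ex g.
Proof. by move=> /bpast_integrable ? /bpast_integrable ?; exact: RintegralB. Qed.

Lemma ExZ D c f : bpast D f -> Ex (fun w => c * f w) = c * Ex f.
Proof. by move=> /bpast_integrable ?; exact: RintegralZl. Qed.

Lemma Ex_le D f g : bpast D f -> bpast D g -> (forall w, f w <= g w) -> Ex f <= Ex g.
Proof. by move=> /bpast_integrable ? /bpast_integrable ? ?; exact: le_Rintegral. Qed.

Lemma Ex_ge0 f : (forall w, 0 <= f w) -> 0 <= Ex f.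
Proof. by move=> f0; exact: Rintegral_ge0. Qed.

Hypothesis omega_indep :
  mutually_independent P (fun x => sigma_gen_rv (omega x)).

(** By [past_indep] the pair formed by [f] and [phi (omega j)] has a product law, and Fubini leaves
    the mean of [phi] as inner integral. This takes the place of conditional expectation given the
    past. *)
Lemma Ex_past_uncor D f j (phi : R -> R) (M : R) : bpast D f -> ~ D j ->
  measurable_fun setT phi -> (forall x, `|phi x| <= M) ->
  Ex (fun w => phi (omega j w)) = 0 ->
  Ex (fun w => f w * phi (omega j w)) = 0.
Proof.
move=> bf nDj mphi bphi E0.
have mf := bpast_measurable bf.
pose Y w := phi (omega j w).
have bY : bpast [set: int] Y by apply: bpast_omega bphi.
have mY := bpast_measurable bY.
have mfY : measurable_fun [set: T] (fun w => (f w, Y w)).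
  exact: measurable_fun_pair.
pose X1 : {RV P >-> R} := HB.pack f (isMeasurableFun.Build _ _ _ _ f mf).
pose X2 : {RV P >-> R} := HB.pack Y (isMeasurableFun.Build _ _ _ _ Y mY).
pose X : {RV P >-> (R * R)%type} :=
  HB.pack (fun w => (f w, Y w)) (isMeasurableFun.Build _ _ _ _ _ mfY).
have law : forall A, measurable A ->
    (distribution P X1 \x distribution P X2)%E A = distribution P X A.
  apply: product_measure_unique => A B mA mB.
  have mfA : <<s past_gen omega D >> (f @^-1` A).
    by have := bf.1 measurableT _ mA; rewrite setTI.
  have mB' : measurable (phi @^-1` B) by rewrite -[X in measurable X]setTI; exact: mphi.
  exact: (past_indep omega_indep nDj mfA mB').
have mprod : measurable_fun [set: R * R] (fun z : R * R => (z.1 * z.2)%:E).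
  by apply/measurable_EFinP; apply: measurable_funM.
have iprod : P.-integrable setT ((fun z : R * R => (z.1 * z.2)%:E) \o X).
  have : bpast [set: int] (fun w => f w * Y w).
    by apply: bpastM => //; apply: bpast_sub bf.
  exact: bpast_integrable.
rewrite /Ex /Rintegral.
have -> : (\int[P]_w (f w * phi (omega j w))%:E =
   \int[distribution P X]_z (z.1 * z.2)%:E)%E.
  by rewrite integral_distribution.
have -> : (\int[distribution P X]_z (z.1 * z.2)%:E =
   \int[distribution P X1 \x distribution P X2]_z (z.1 * z.2)%:E)%E.
  by apply: eq_measure_integral => A mA _; exact/esym/law.
rewrite -integral12_prod_meas1; last first.
  have /integrableP[_ fin] :
      (distribution P X).-integrable setT (fun z : R * R => (z.1 * z.2)%:E).
    by apply: integrable_pushforward.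
  apply/integrableP; split => //.
  rewrite (eq_measure_integral (distribution P X))// => A mA _.
  exact: law.
rewrite integral0_eq// => x _; rewrite /fubini_F/=.
have iX2 : (distribution P X2).-integrable setT (EFin : R -> \bar R).
  by apply: integrable_pushforward => //; exact: bpast_integrable bY.
under eq_integral do rewrite EFinM.
rewrite integralZl//.
rewrite integral_distribution//; last exact: bpast_integrable bY.
have -> : (\int[P]_x0 (EFin \o X2) x0 = (Ex Y)%:E)%E.
  rewrite /Ex /Rintegral fineK//.
  exact: integrable_fin_num (bpast_integrable bY).
by rewrite E0 mule0.
Qed.

End bpast.

(** * The potential stopped when leaving a valley *)

(* State of the potential explored outwards from the origin: current height,
   running minimum [m], sum of [exp (m - V)] over the visited sites, and whether
   height [5h] has been reached.  The exploration succeeds at height [10h] and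
   fails at [-h]; it also fails when it returns to [0] after [5h], so that on
   success the minimum is attained before height [5h]. *)
Record vstate (R : Type) :=
  VState { vpos : R; vmin : R; vsum : R; vhigh : bool }.

Section valley_state.
Context (R : realType) (h : R).
Implicit Types (x : R) (t : vstate R).

Definition stopped t : bool :=
  [|| vpos t <= - h, 10 * h <= vpos t | vhigh t && (vpos t <= 0)].

(** [vsum] is relative to the running minimum: a new minimum rescales the old sum, and the new site
    then contributes 1. Stopped states are frozen. *)
Definition vstep x t : vstate R :=
  if stopped t then t else
  let v := vpos t + x in
  VState v (Num.min (vmin t) v)
    (expR (Num.min (v - vmin t) 0) * vsum t + expR (- Num.max (v - vmin t) 0))
    (vhigh t || (5 * h <= v)).

(** Heights are measured from the starting edge, and [s0] accounts for the sites explored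
    earlier. *)
Fixpoint vrun (s0 : R) (xi : nat -> R) (n : nat) : vstate R :=
  if n is k.+1 then vstep (xi k) (vrun s0 xi k) else VState 0 0 s0 false.

End valley_state.

(** * One-step inequalities for the (super)martingales *)

Section valley_lyapunov.
Context (R : realType) (h C : R).
Hypotheses (h_gt0 : 0 < h) (C_ge4 : 4 <= C).
Implicit Types (x : R) (t : vstate R).

(* Gambler's ruin for the two successive climbs from [-h] to [5h] and from [0]
   to [10h]; the factor [5/6] makes the passage at height [5h] nondecreasing. *)
Definition climb t : R :=
  (if vhigh t then vpos t else 5 / 6 * (vpos t + h)) / (10 * h + C).

Definition climb_slope t : R :=
  (if vhigh t then 1 else 5 / 6) / (10 * h + C).

(** The correction is linear in the new increment, hence centred given the past: [climb] is a
    submartingale. *)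
Lemma climb_step x t : ~~ stopped h t ->
  climb t + climb_slope t * x <= climb (vstep h x t).
Proof.
have h0 := h_gt0; have C4 := C_ge4; have dpos : 0 < 10 * h + C by lra.
move=> nst; have nst' := nst; move: nst'.
rewrite /stopped !negb_or -!ltNge => /and3P[v1 v2 v3].
rewrite /vstep (negbTE nst) /climb /climb_slope /=.
rewrite [_ / _ * x]mulrAC -mulrDl ler_pM2r ?invr_gt0//.
move: v3; case: (vhigh t) => /= v3; first by lra.
by case: ifPn; lra.
Qed.

(** A failed run has nonpositive [climb]; otherwise the overshoot above [10h] is at most [C], so
    [climb] is at most 1. *)
Lemma climb_stopped_le t : vpos t <= 10 * h + C ->
  climb t <= (~~ stopped h t)%:R + (10 * h <= vpos t)%R%:R.
Proof.
have h0 := h_gt0; have C4 := C_ge4; move=> vle; have dpos : 0 < 10 * h + C by lra.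
have le1 : climb t <= 1.
  rewrite /climb ler_pdivrMr// mul1r; case: ifP => _ //.
  by lra.
case: (boolP (10 * h <= vpos t)) => v1 /=.
  by rewrite (le_trans le1)// lerDr ler0n.
rewrite addr0; case: (boolP (stopped h t)) => //=.
rewrite /stopped (negbTE v1) /= /climb => st.
rewrite pmulr_lle0 ?invr_gt0//.
by move: st; case: (vhigh t) => /=; rewrite ?andbT ?orbF; [case/orP; lra|lra].
Qed.

(** For [x <= 4], square [1 - x / 4 <= expR (- (x / 4))] and use [4 * C >= 16]; beyond that the left
    side is negative. *)
Lemma expR_half_ge x : `|x| <= C ->
  1 - x / 2 + x ^+ 2 / (4 * C) <= expR (- (x / 2)).
Proof.
have C4 := C_ge4.
rewrite ler_norml => /andP[x1 x2].
have Cpos : 0 < C by lra.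
case: (lerP (x / 2) 2) => hx.
  have e : expR (- (x / 2)) = expR (- (x / 4)) ^+ 2.
    by rewrite expr2 -expRD; congr expR; field.
  have := expR_ge1Dx (- (x / 4)) => h1.
  have h2 : (1 + - (x / 4)) ^+ 2 <= expR (- (x / 4)) ^+ 2.
    by rewrite ler_pXn2r// nnegrE ?expR_ge0//; lra.
  rewrite e; apply: le_trans h2.
  have : x ^+ 2 / (4 * C) <= x ^+ 2 / 16.
    by rewrite ler_wpM2l ?sqr_ge0// lef_pV2 ?posrE; lra.
  by nra.
apply: le_trans (expR_ge0 _).
have : x ^+ 2 / (4 * C) <= x / 4.
  rewrite ler_pdivrMr; last by lra.
  by nra.
by lra.
Qed.

Context (sigma2 : R).
Hypothesis sigma2_gt0 : 0 < sigma2.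

(** Solves [lyapB / (4 * C) * sigma2 = 2 * (1 + C) * expR (C / 2)]: the mean gain from the curvature
    of the exponential then covers the contribution of one new site. *)
Definition lyapB : R := 2 * (1 + C) * expR (C / 2) * (4 * C) / sigma2.
(** Makes the decrease of [lyapD * vmin] at a new minimum outweigh the reset of the exponential
    term. *)
Definition lyapD : R := lyapB * expR (C / 2).

Lemma lyapB_gt0 : 0 < lyapB.
Proof. by have C4 := C_ge4; rewrite /lyapB !mulr_gt0 ?invr_gt0 ?expR_gt0//; lra. Qed.

Lemma lyapD_gt0 : 0 < lyapD.
Proof. by rewrite /lyapD mulr_gt0 ?lyapB_gt0 ?expR_gt0. Qed.

(** A supermartingale whose first term is at least [10 * h * vsum] on success; its small initial
    value therefore bounds the mean of [vsum] there. *)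
Definition lyap t : R :=
  vsum t * (vpos t - vmin t + (1 + C)) -
  lyapB * expR (- ((vpos t - vmin t) / 2)) + lyapD * vmin t.

Definition lyap_slope t : R :=
  vsum t + lyapB * expR (- ((vpos t - vmin t) / 2)) / 2.

Definition lyap_curv t : R :=
  lyapB / (4 * C) * expR (- ((vpos t - vmin t) / 2)).

(** The terms with [lyap_slope] and [lyap_curv] are centred given the past. The curvature of the
    exponential pays for the added site; at a new minimum, the rescaling of [vsum] absorbs the
    change of its factor and [lyapD] that of the exponential. *)
Lemma lyap_step x t : ~~ stopped h t -> `|x| <= C -> 0 <= vsum t ->
  vmin t <= vpos t ->
  lyap (vstep h x t) <=
    lyap t + lyap_slope t * x - lyap_curv t * (x ^+ 2 - sigma2).
Proof.
have C4 := C_ge4; move=> nst xC s0 mv.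
rewrite /vstep (negbTE nst) /lyap /lyap_slope /lyap_curv /=.
set s := vsum t in s0 *; set u := vpos t - vmin t.
have u0 : 0 <= u by rewrite /u subr_ge0.
have -> : vpos t + x - vmin t = u + x by rewrite /u; ring.
have C0 : 0 < C by lra.
have xC' := xC; move: xC'; rewrite ler_norml => /andP[x1 x2].
set e := expR (- (u / 2)).
have e0 : 0 < e by exact: expR_gt0.
set g := expR (C / 2).
have g0 : 0 < g by exact: expR_gt0.
have B0 := lyapB_gt0.
(* the quadratic part of the exponential pays for the terms added to [vsum] *)
have Be : lyapB * expR (- ((u + x) / 2)) >=
    lyapB * e * (1 - x / 2 + x ^+ 2 / (4 * C)).
  have -> : expR (- ((u + x) / 2)) = e * expR (- (x / 2)).
    by rewrite /e -expRD; congr expR; field.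
  rewrite -mulrA ler_pM2l// ler_pM2l//.
  exact: expR_half_ge.
have kE : lyapB / (4 * C) * sigma2 = 2 * (1 + C) * g.
  by rewrite /lyapB -/g; field; rewrite !gt_eqF.
(* A new minimum forces [u <= C], where the curvature gain is still bounded below. *)
have ge1 : u <= C -> 1 <= g * e.
  by move=> uC; rewrite /g /e -expRD -[leLHS](@expR0 R) ler_expR; lra.
have -> : Num.min (vmin t) (vpos t + x) = vmin t + Num.min (u + x) 0.
  by rewrite /u; case: (lerP (vmin t)) => a1; case: (lerP _ 0) => a2; lra.
have -> : vpos t + x - (vmin t + Num.min (u + x) 0) = Num.max (u + x) 0.
  by rewrite /u; case: (lerP _ 0) => a2; lra.
set k := lyapB / (4 * C) in kE *.
have -> : k * e * (x ^+ 2 - sigma2) = k * e * x ^+ 2 - 2 * (1 + C) * (g * e).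
  by rewrite mulrBr; congr (_ - _); rewrite mulrAC kE; ring.
have Be' : lyapB * e * (1 - x / 2 + x ^+ 2 / (4 * C)) =
    lyapB * e - lyapB * e * x / 2 + k * e * x ^+ 2.
  by rewrite /k; field; lra.
rewrite Be' in Be.
case: (lerP 0 (u + x)) => hw.
- rewrite expR0 mul1r addr0.
  have h1 : expR (- (u + x)) * (u + x + (1 + C)) <= 2 * (1 + C) * (g * e).
    have h2 : u + x + (1 + C) <= 2 * (1 + C) * expR ((u + x) / 2).
      have := expR_ge1Dx ((u + x) / 2) => h3.
      have : 2 * (1 + C) * (1 + (u + x) / 2) <= 2 * (1 + C) * expR ((u + x) / 2).
        by rewrite ler_pM2l//; lra.
      by nra.
    apply: (@le_trans _ _ (expR (- (u + x)) * (2 * (1 + C) * expR ((u + x) / 2)))).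
      by rewrite ler_pM2l ?expR_gt0.
    rewrite mulrCA -expRD ler_pM2l; last by lra.
    by rewrite /g /e -expRD ler_expR; lra.
  by rewrite mulrDl; nra.
- have uC : u <= C by lra.
  have := ge1 uC => ge1'.
  rewrite oppr0 expR0 mul0r oppr0 expR0 add0r.
  (* With [w = u + x] in [[-C, 0]], this follows from [expR w <= 1 / (1 - w)]. *)
  have h1 : expR (u + x) * (1 + C) <= u + x + (1 + C).
    have h2 := expR_ge1Dx (- (u + x)).
    have h3 : expR (u + x) * expR (- (u + x)) = 1 by rewrite -expRD subrr expR0.
    have h4 := expR_gt0 (u + x).
    have h5 : expR (u + x) * (1 - (u + x)) <= 1.
      by rewrite -[leRHS]h3 ler_pM2l.
    have h6 : 1 + C <= (u + x + (1 + C)) * (1 - (u + x)).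
      by nra.
    have h7 : 0 < 1 - (u + x) by lra.
    rewrite -(ler_pM2r h7).
    apply: le_trans h6.
    rewrite mulrAC; nra.
  have h2 : lyapB * expR (- ((u + x) / 2)) <= lyapB - lyapD * (u + x).
    rewrite /lyapD -/g.
    have -> : lyapB - lyapB * g * (u + x) = lyapB * (1 - g * (u + x)) by ring.
    rewrite ler_pM2l//.
    have h3 := expR_ge1Dx ((u + x) / 2).
    have h4 : expR ((u + x) / 2) * expR (- ((u + x) / 2)) = 1.
      by rewrite -expRD subrr expR0.
    have h5 : expR (- ((u + x) / 2)) <= g by rewrite ler_expR; lra.
    have h6 := expR_gt0 (- ((u + x) / 2)).
    nra.
  have h3 : s * (expR (u + x) * (1 + C)) <= s * (u + x + (1 + C)).
    exact: ler_wpM2l.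
  nra.
Qed.

End valley_lyapunov.

(** * The shape of the potential along a run *)

Section valley_run.
Context (R : realType) (h C s0 : R) (xi : nat -> R).

Definition partial_sum (i : nat) : R := \sum_(k < i) xi k.
Local Notation S := partial_sum.

Lemma partial_sumS i : S i.+1 = S i + xi i.
Proof. by rewrite /S big_ord_recr. Qed.

Lemma partial_sum0 : S 0 = 0.
Proof. by rewrite /S big_ord0. Qed.

Lemma vrun_bounds n : 0 < h -> 0 <= C -> 0 <= s0 -> (forall k, `|xi k| <= C) ->
  let t := vrun h s0 xi n in
  [/\ vmin t <= vpos t, vmin t <= 0, - h - C <= vmin t, vpos t <= 10 * h + C &
    0 <= vsum t].
Proof.
move=> h0 C0 s00 xiC /=.
(* Strengthened for the induction: a minimum at or below [-h] is the current position, so the run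
   has stopped there and overshoots only once. *)
suff : let t := vrun h s0 xi n in
  [/\ vmin t <= vpos t, vmin t <= 0, - h - C <= vmin t, vpos t <= 10 * h + C &
    0 <= vsum t] /\ (- h < vmin t \/ vmin t = vpos t) by move=> [].
elim: n => [|n /= [[i1 i2 i3 i4 i5] i6]] /=; first by split; [split; lra|left; lra].
rewrite /vstep; case: ifPn => // nst.
move: nst; rewrite /stopped !negb_or -!ltNge => /and3P[v1 v2 _] /=.
have := xiC n; rewrite ler_norml => /andP[x1 x2].
split; last first.
  case: (lerP (vmin (vrun h s0 xi n))) => hm; last by right.
  by left; case: i6 => i6; lra.
split.
- by rewrite ge_min lexx orbT.
- by rewrite ge_min i2.
- by rewrite le_min i3 /=; lra.
- by lra.
- by rewrite addr_ge0 ?mulr_ge0 ?expR_ge0.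
Qed.

(** [T] counts the steps actually made and [j] is a time of minimum. The last clause serves the
    induction: it gives the bound by [5h] when the minimum moves. *)
Definition valley_at (T j : nat) (t : vstate R) : Prop :=
  [/\ (j <= T)%N, vpos t = S T, vmin t = S j &
    (forall i, (i <= T)%N -> S j <= S i)] /\
  [/\ (forall i, (i <= j)%N -> S i < 5 * h),
     - h < S j,
     vsum t = s0 * expR (S j) + \sum_(1 <= i < T.+1) expR (- (S i - S j)) &
     (~~ vhigh t -> forall i, (i <= T)%N -> S i < 5 * h)].

Definition failed (t : vstate R) : bool :=
  (vpos t <= - h) || (vhigh t && (vpos t <= 0)).

(** Once [5h] has been reached, a new minimum would be negative, hence a failure. So the bottom is
    attained while the path is still below [5h]. *)
Lemma vrun_valley n : 0 < h -> let t := vrun h s0 xi n in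
  failed t \/ exists T j, [/\ (T <= n)%N, valley_at T j t &
    (~~ stopped h t -> T = n)].
Proof.
move=> h0; elim: n => [|n /= IH].
  right; exists 0%N, 0%N; split => //; split; split => //=.
  - by rewrite partial_sum0.
  - by rewrite partial_sum0.
  - by move=> i; rewrite leqn0 => /eqP ->.
  - by move=> i; rewrite leqn0 => /eqP ->; rewrite partial_sum0; lra.
  - by rewrite partial_sum0; lra.
  - by rewrite partial_sum0 expR0 mulr1 big_geq// addr0.
  - by move=> _ i; rewrite leqn0 => /eqP ->; rewrite partial_sum0; lra.
set t := vrun h s0 xi n in IH *.
rewrite /= -/t; rewrite /vstep; case: ifPn => [st|nst].
  case: IH => [|[T [j [Tn V nT]]]]; first by left.
  by right; exists T, j; split => //; [exact: leqW|rewrite st].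
case: IH => [ft|[T [j [Tn V nT]]]].
  by move: nst; rewrite /stopped; case/orP: ft => ->; rewrite ?orbT.
have {nT}TE := nT nst; subst T.
have {V}[[jn pE mE Smin] [Slt5 jh sE low]] := V.
have nst' := nst; move: nst'.
rewrite /stopped !negb_or -!ltNge => /and3P[v1 v2 v3].
set v := vpos t + xi n.
have vE : v = S n.+1 by rewrite partial_sumS -pE.
have m0 : vmin t <= 0 by rewrite mE -[leRHS]partial_sum0; exact: Smin.
case: (boolP (failed (VState v (Num.min (vmin t) v)
  (expR (Num.min (v - vmin t) 0) * vsum t + expR (- Num.max (v - vmin t) 0))
  (vhigh t || (5 * h <= v))))) => [|nf]; first by left.
right; exists n.+1.
move: nf; rewrite /failed /= negb_or -ltNge => /andP[v4 v5].
case: (lerP (vmin t) v) => mv.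
  exists j; split => //; split; split => //=.
  - exact: leqW.
  - move=> i; rewrite leq_eqVlt => /orP[/eqP ->|]; last exact: Smin.
    by rewrite -vE -mE.
  - rewrite [in RHS]big_nat_recr//= addrA -sE -vE -mE.
    case: (lerP (v - vmin t) 0) => h1.
      have -> : v = vmin t by lra.
      by rewrite subrr oppr0 !expR0 mul1r.
    by rewrite expR0 mul1r.
  - rewrite negb_or -ltNge => /andP[zl vl] i; rewrite leq_eqVlt => /orP[/eqP ->|].
      by rewrite -vE.
    exact: low.
exists n.+1; have vz : ~~ vhigh t.
  by move: v5; rewrite negb_and -ltNge; case: (vhigh t) => //=; lra.
have lowall i : (i <= n.+1)%N -> S i < 5 * h.
  rewrite leq_eqVlt => /orP[/eqP ->|]; last exact: low.
  by rewrite -vE; lra.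
split => //; split; split => //=.
- move=> i; rewrite leq_eqVlt => /orP[/eqP -> //|/Smin].
  by rewrite -vE -mE; lra.
- by rewrite -vE.
- rewrite -vE; have -> : Num.min (v - vmin t) 0 = v - vmin t by rewrite min_l; lra.
  have -> : Num.max (v - vmin t) 0 = 0 by rewrite max_r; lra.
  rewrite [in RHS]big_nat_recr//= -vE subrr oppr0 expR0 sE addrA; congr (_ + _).
  rewrite mulrDr; congr (_ + _).
    by rewrite mulrCA -expRD mE; congr (_ * expR _); ring.
  rewrite mulr_sumr; apply: eq_bigr => i _.
  by rewrite -expRD mE; congr expR; ring.
Qed.

Lemma vrun_success n : 0 < h -> 10 * h <= vpos (vrun h s0 xi n) ->
  exists T j, [/\ (j <= T <= n)%N, 10 * h <= S T,
    (forall i, (i <= T)%N -> S j <= S i), - h < S j &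
    (forall i, (i <= j)%N -> S i <= 5 * h)] /\
    s0 * expR (S j) + \sum_(1 <= i < T.+1) expR (- (S i - S j)) =
      vsum (vrun h s0 xi n).
Proof.
move=> h0 vh; case: (vrun_valley n h0) => /= [|[T [j [Tn V _]]]].
  by rewrite /failed => /orP[|/andP[_]]; lra.
have {V}[[jn pE mE Smin] [Slt5 jh sE low]] := V.
exists T, j; rewrite jn Tn sE -pE vh; split => //; split => // i ij.
exact/ltW/Slt5.
Qed.

End valley_run.

(** * The probability that a block of fresh sites is good *)

Section valley_block.
Context d (T : measurableType d) (R : realType) (P : probability T R)
  (omega : int -> {RV P >-> R}) (C sigma2 : R) (psi : R -> R).
Hypotheses
  (omega_indep : mutually_independent P (fun x => sigma_gen_rv (omega x)))
  (C_ge4 : 4 <= C) (sigma2_gt0 : 0 < sigma2)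
  (psi_meas : measurable_fun setT psi) (psi_le : forall x, `|psi x| <= C)
  (psi_mean : forall j, Ex P (fun w => psi (omega j w)) = 0)
  (psi_var : forall j, Ex P (fun w => psi (omega j w) ^+ 2) = sigma2).
Context (D : set int) (site : nat -> int).
Hypotheses (site_inj : injective site) (site_new : forall i, ~ D (site i)).
Context (h s0 : R).
Hypotheses (h_ge : C <= h) (s0_ge0 : 0 <= s0) (s0_le : s0 * (1 + C) <= h).

Local Notation E := (Ex P).

Definition sites_upto (k : nat) : set int :=
  D `|` [set site i | i in [set i | (i < k)%N]].

Lemma sites_upto_sub k : D `<=` sites_upto k.
Proof. by move=> x; left. Qed.

Lemma sites_uptoS k : sites_upto k `<=` sites_upto k.+1.
Proof.
by move=> x [|[i ik <-]]; [left|right; exists i => //; exact: ltnW].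
Qed.

Lemma site_notin k : ~ sites_upto k (site k).
Proof.
by case=> [/site_new//|[i /= ik /site_inj ki]]; rewrite ki ltnn in ik.
Qed.

Lemma psi_bpast k : bpast omega (sites_upto k.+1) (fun w => psi (omega (site k) w)).
Proof. by apply: bpast_omega psi_meas psi_le; right; exists k => /=. Qed.

Definition block_run (k : nat) (w : T) : vstate R :=
  vrun h s0 (fun i => psi (omega (site i) w)) k.
Local Notation st := block_run.

Lemma block_run_past k : [/\ bpast omega (sites_upto k) (fun w => vpos (st k w)),
  bpast omega (sites_upto k) (fun w => vmin (st k w)),
  bpast omega (sites_upto k) (fun w => vsum (st k w)),
  mpast omega (sites_upto k) (fun w => vhigh (st k w)) &
  mpast omega (sites_upto k) (fun w => stopped h (st k w))].
Proof.
suff H : [/\ bpast omega (sites_upto k) (fun w => vpos (st k w)),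
  bpast omega (sites_upto k) (fun w => vmin (st k w)),
  bpast omega (sites_upto k) (fun w => vsum (st k w)) &
  mpast omega (sites_upto k) (fun w => vhigh (st k w))].
  case: H => i1 i2 i3 i4; split => //.
  apply: mpast_or; first by apply: mpast_le => //; exact: bpast_cst.
  apply: mpast_or; first by apply: mpast_le => //; exact: bpast_cst.
  by apply: mpast_and => //; apply: mpast_le => //; exact: bpast_cst.
elim: k => [|k [i1 i2 i3 i4]].
  split; try exact: bpast_cst.
  exact: measurable_cst.
have i5 : mpast omega (sites_upto k) (fun w => stopped h (st k w)).
  apply: mpast_or; first by apply: mpast_le => //; exact: bpast_cst.
  apply: mpast_or; first by apply: mpast_le => //; exact: bpast_cst.
  by apply: mpast_and => //; apply: mpast_le => //; exact: bpast_cst.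
have psik := psi_bpast k.
have {}i1 := bpast_sub (@sites_uptoS k) i1.
have {}i2 := bpast_sub (@sites_uptoS k) i2.
have {}i3 := bpast_sub (@sites_uptoS k) i3.
have {}i4 := mpast_sub (@sites_uptoS k) i4.
have {}i5 := mpast_sub (@sites_uptoS k) i5.
have c0 : bpast omega (sites_upto k.+1) (fun=> 0) by exact: bpast_cst.
have v' := bpastD i1 psik.
split.
- have -> : (fun w => vpos (st k.+1 w)) = (fun w => if stopped h (st k w)
    then vpos (st k w) else vpos (st k w) + psi (omega (site k) w)).
    by apply/funext => w; rewrite /st /= /vstep; case: ifP.
  exact: bpast_if.
- have -> : (fun w => vmin (st k.+1 w)) = (fun w => if stopped h (st k w)
    then vmin (st k w)
    else Num.min (vmin (st k w)) (vpos (st k w) + psi (omega (site k) w))).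
    by apply/funext => w; rewrite /st /= /vstep; case: ifP.
  by apply: bpast_if => //; exact: bpast_min.
- have -> : (fun w => vsum (st k.+1 w)) = (fun w => if stopped h (st k w)
    then vsum (st k w) else
    let u := vpos (st k w) + psi (omega (site k) w) - vmin (st k w) in
    expR (Num.min u 0) * vsum (st k w) + expR (0 - Num.max u 0)).
    apply/funext => w; rewrite /st /= /vstep; case: ifP => //= _.
    by rewrite sub0r.
  have u' := bpastB v' i2.
  apply: bpast_if => //; apply: bpastD.
    by apply: bpastM => //; apply: bpast_expR; exact: bpast_min.
  by apply: bpast_expR; apply: bpastB => //; exact: bpast_max.
- have -> : (fun w => vhigh (st k.+1 w)) = (fun w => if stopped h (st k w)
    then vhigh (st k w) else vhigh (st k w) ||
      (5 * h <= vpos (st k w) + psi (omega (site k) w))).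
    by apply/funext => w; rewrite /st /= /vstep; case: ifP.
  apply: mpast_if => //; apply: mpast_or => //; apply: mpast_le => //.
  exact: bpast_cst.
Qed.

(** One supermartingale step: [a] and [b] involve only sites before [site k], so both corrections
    have expectation zero. *)
Lemma Ex_step k A A' a b : bpast omega (sites_upto k) A ->
  bpast omega (sites_upto k) a -> bpast omega (sites_upto k) b ->
  bpast omega (sites_upto k.+1) A' ->
  (forall w, A' w <= A w + a w * psi (omega (site k) w)
    + b w * (psi (omega (site k) w) ^+ 2 - sigma2)) ->
  E A' <= E A.
Proof.
move=> hA ha hb hA' le; have sub := @sites_uptoS k.
have psik := psi_bpast k.
have psi2k : bpast omega (sites_upto k.+1)
    (fun w => psi (omega (site k) w) ^+ 2 - sigma2).
  by apply: bpastB; [exact: (bpastM psik psik)|exact: bpast_cst].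
have ga := bpast_sub sub ha; have gb := bpast_sub sub hb.
have gA := bpast_sub sub hA.
have m1 := bpastM ga psik; have m2 := bpastM gb psi2k.
have m3 := bpastD gA m1; have m4 := bpastD m3 m2.
apply: le_trans (Ex_le hA' m4 le) _.
rewrite (ExD m3 m2) (ExD gA m1).
rewrite (Ex_past_uncor omega_indep ha (@site_notin k) psi_meas psi_le) //.
have bound x : `|psi x ^+ 2 - sigma2| <= C ^+ 2 + sigma2.
  apply: le_trans (ler_normB _ _) _; rewrite normrX (gtr0_norm sigma2_gt0) lerD2r.
  by rewrite ler_pXn2r// ?nnegrE//; exact: le_trans (psi_le x).
rewrite (Ex_past_uncor (phi := fun x => psi x ^+ 2 - sigma2) omega_indep hb
  (@site_notin k) _ bound) ?addr0//.
  by apply: measurable_funB => //; exact: measurable_funX.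
have p2 : bpast omega (sites_upto k.+1) (fun w => psi (omega (site k) w) ^+ 2).
  exact: (bpastM psik psik).
rewrite (ExB p2 (bpast_cst _ _ _)) psi_var Ex_cst subrr//.
Qed.

Context (F : T -> R).
Hypotheses (F_past : bpast omega D F) (F_ge0 : forall w, 0 <= F w).

Definition alive k (w : T) : R := if stopped h (st k w) then 0 else 1.
Definition reached k (w : T) : R := if 10 * h <= vpos (st k w) then 1 else 0.

Lemma F_bpast k : bpast omega (sites_upto k) F.
Proof. exact: bpast_sub (@sites_upto_sub k) F_past. Qed.

Lemma alive_bpast k : bpast omega (sites_upto k) (alive k).
Proof.
have [_ _ _ _ i5] := block_run_past k.
by apply: bpast_if => //; exact: bpast_cst.
Qed.

Lemma reached_bpast k : bpast omega (sites_upto k) (reached k).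
Proof.
have [i1 _ _ _ _] := block_run_past k.
apply: bpast_if; try exact: bpast_cst.
by apply: mpast_le => //; exact: bpast_cst.
Qed.

Lemma block_bounds k w : let t := st k w in
  [/\ vmin t <= vpos t, vmin t <= 0, - h - C <= vmin t, vpos t <= 10 * h + C &
    0 <= vsum t].
Proof.
have C4 := C_ge4; have hC := h_ge.
by apply: vrun_bounds => //; lra.
Qed.

Lemma climb_past k : bpast omega (sites_upto k) (fun w => climb h C (st k w)).
Proof.
have [i1 i2 i3 i4 i5] := block_run_past k.
rewrite /climb; apply: bpastM; last exact: bpast_cst.
apply: bpast_if => //; apply: bpastM; first exact: bpast_cst.
by apply: bpastD => //; exact: bpast_cst.
Qed.

(** The initial value [5 / 6 * h / (10 * h + C)] is at least [5 / 66] because [C <= h], and the mean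
    does not decrease. *)
Lemma Ex_climb k : E F * (5 / 66) <= E (fun w => F w * climb h C (st k w)).
Proof.
have C4 := C_ge4; have hC := h_ge; have h0 : 0 < h by lra.
elim: k => [|k IH].
  rewrite (_ : (fun w => _) = (fun w => (5 / 6 * h / (10 * h + C)) * F w)).
    rewrite (ExZ _ (F_bpast 0)) mulrC ler_wpM2r//; first exact: Ex_ge0.
    rewrite ler_pdivlMr; lra.
  by apply/funext => w; rewrite /climb /= add0r mulrC.
(* [Ex_step] bounds from above, so it is applied to the negated submartingale. *)
apply: le_trans IH _; rewrite -lerN2.
have Fk := F_bpast k; have ck := climb_past k; have ak := alive_bpast k.
have [i1 i2 i3 i4 i5] := block_run_past k.
have z := @bpast_cst _ _ _ _ omega (sites_upto k) 0.
have neg j f : bpast omega (sites_upto j) f -> - E f = E (fun w => - 1 * f w).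
  by move=> bf; rewrite (ExZ _ bf) mulN1r.
have F1 := bpastM (F_bpast k.+1) (climb_past k.+1).
rewrite (neg _ _ F1) (neg _ _ (bpastM Fk ck)).
pose sl w := climb_slope h C (st k w).
have slp : bpast omega (sites_upto k) sl.
  rewrite /sl /climb_slope; apply: bpastM; last exact: bpast_cst.
  by apply: bpast_if => //; exact: bpast_cst.
apply: (@Ex_step k _ _ (fun w => - 1 * (F w * (alive k w * sl w))) (fun=> 0)).
- by apply: bpastM; [exact: bpast_cst|exact: bpastM].
- apply: bpastM; first exact: bpast_cst.
  by apply: bpastM => //; exact: bpastM.
- exact: bpast_cst.
- by apply: bpastM => //; exact: bpast_cst.
move=> w; rewrite mul0r addr0 !mulN1r mulNr -opprD lerN2 -mulrA -mulrDr.
apply: ler_wpM2l; first exact: F_ge0.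
rewrite /alive /sl; case: ifPn => [st|nst].
  by rewrite !mul0r addr0 {2}/block_run /= /vstep -/(block_run k w) st.
by rewrite mul1r; exact: climb_step.
Qed.

Lemma alive_le k w : alive k.+1 w <= alive k w.
Proof.
rewrite /alive {1}/block_run /= /vstep -/(block_run k w).
case E0: (stopped h (st k w)); first by rewrite E0.
by case: ifP.
Qed.

(** While the run is alive, the square of the position gains [sigma2] per step on average, and it
    never exceeds [(11 h)^2]. *)
Lemma Ex_alive n : sigma2 * n%:R * E (fun w => F w * alive n w) <= E F * (121 * h ^+ 2).
Proof.
have C4 := C_ge4; have hC := h_ge; have h0 : 0 < h by lra.
have vp k : bpast omega (sites_upto k) (fun w => F w * vpos (st k w) ^+ 2).
  have [i1 _ _ _ _] := block_run_past k.
  by apply: bpastM; [exact: F_bpast|exact: (bpastM i1 i1)].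
have ap k : bpast omega (sites_upto k) (fun w => F w * alive k w).
  by apply: bpastM; [exact: F_bpast|exact: alive_bpast].
have step k : E (fun w => F w * vpos (st k w) ^+ 2)
    + sigma2 * E (fun w => F w * alive k w) <=
    E (fun w => F w * vpos (st k.+1 w) ^+ 2).
  have c1 := bpastM (@bpast_cst _ _ _ _ omega (sites_upto k) sigma2) (ap k).
  rewrite -(ExZ _ (ap k)) -(ExD (vp k) c1) -lerN2.
  have c2 := bpastD (vp k) c1.
  have neg j f : bpast omega (sites_upto j) f -> - E f = E (fun w => - 1 * f w).
    by move=> bf; rewrite (ExZ _ bf) mulN1r.
  rewrite (neg _ _ c2) (neg _ _ (vp k.+1)).
  have [i1 _ _ _ _] := block_run_past k.
  apply: (@Ex_step k _ _ (fun w => - 2 * (F w * alive k w * vpos (st k w)))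
    (fun w => - 1 * (F w * alive k w))).
  - by apply: bpastM => //; exact: bpast_cst.
  - by apply: bpastM; [exact: bpast_cst|exact: bpastM].
  - by apply: bpastM; [exact: bpast_cst|].
  - by apply: bpastM => //; exact: bpast_cst.
  move=> w; rewrite /alive; case: ifPn => [stp|nst].
    have -> : vpos (st k.+1 w) = vpos (st k w).
      by rewrite {1}/block_run /= /vstep -/(block_run k w) stp.
    by rewrite !mulr0 !mul0r !mulr0 !mul0r !addr0.
  have -> : vpos (st k.+1 w) = vpos (st k w) + psi (omega (site k) w).
    by rewrite {1}/block_run /= /vstep -/(block_run k w) (negbTE nst).
  by rewrite le_eqVlt; apply/orP; left; apply/eqP; ring.
have mono k : E (fun w => F w * alive k.+1 w) <= E (fun w => F w * alive k w).
  apply: (Ex_le (ap k.+1) (bpast_sub (@sites_uptoS k) (ap k))) => w.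
  by apply: ler_wpM2l => //; exact: alive_le.
have low k : (k <= n)%N ->
    E (fun w => F w * alive n w) <= E (fun w => F w * alive k w).
  elim: n => [|m IH]; first by rewrite leqn0 => /eqP ->.
  rewrite leq_eqVlt => /orP[/eqP ->//|km].
  exact: le_trans (mono m) (IH km).
have acc k : (k <= n)%N -> sigma2 * k%:R * E (fun w => F w * alive n w) <=
    E (fun w => F w * vpos (st k w) ^+ 2).
  elim: k => [_|k IH kn].
    rewrite mulr0 mul0r; apply: Ex_ge0 => w.
    by rewrite mulr_ge0 ?sqr_ge0.
  apply: le_trans (step k); rewrite -natr1 mulrDr mulr1 mulrDl lerD//.
    by apply: IH; exact: ltnW.
  by rewrite ler_pM2l//; apply: low; exact: ltnW.
apply: le_trans (acc n (leqnn n)) _.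
have Fn := F_bpast n.
have -> : E F * (121 * h ^+ 2) = E (fun w => (121 * h ^+ 2) * F w).
  by rewrite (ExZ _ Fn) mulrC.
apply: (Ex_le (vp n)); first by apply: bpastM => //; exact: bpast_cst.
move=> w; rewrite mulrC ler_wpM2r//.
have [b1 b2 b3 b4 b5] := block_bounds n w; nra.
Qed.

Local Notation B := (lyapB C sigma2).
Local Notation DD := (lyapD C sigma2).

Lemma lyap_past k : bpast omega (sites_upto k) (fun w => lyap C sigma2 (st k w)) /\
  bpast omega (sites_upto k) (fun w => expR (- ((vpos (st k w) - vmin (st k w)) / 2))).
Proof.
have [i1 i2 i3 i4 i5] := block_run_past k.
have ex : bpast omega (sites_upto k)
    (fun w => expR (- ((vpos (st k w) - vmin (st k w)) / 2))).
  apply: bpast_expR.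
  under eq_fun do rewrite -mulN1r.
  apply: bpastM; first exact: bpast_cst.
  by apply: bpastM; [exact: bpastB|exact: bpast_cst].
split => //; rewrite /lyap; apply: bpastD.
  apply: bpastB; last by apply: bpastM => //; exact: bpast_cst.
  by apply: bpastM => //; apply: bpastD; [exact: bpastB|exact: bpast_cst].
by apply: bpastM => //; exact: bpast_cst.
Qed.

Lemma Ex_lyap k : E (fun w => F w * lyap C sigma2 (st k w)) <= E F * h.
Proof.
have C4 := C_ge4; have hC := h_ge; have h0 : 0 < h by lra.
have B0 := lyapB_gt0 C_ge4 sigma2_gt0.
elim: k => [|k IH].
  rewrite (_ : (fun w => _) = (fun w => lyap C sigma2 (VState 0 0 s0 false) * F w)).
    rewrite (ExZ _ (F_bpast 0)) mulrC ler_wpM2l//; first exact: Ex_ge0.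
    rewrite /lyap /= subrr mul0r oppr0 expR0 mulr0 addr0 add0r mulr1.
    by have := s0_le; lra.
  by apply/funext => w; rewrite mulrC.
apply: le_trans IH.
have Fk := F_bpast k; have [lk ek] := lyap_past k; have ak := alive_bpast k.
have [i1 i2 i3 i4 i5] := block_run_past k.
pose sl w := lyap_slope C sigma2 (st k w).
pose cu w := lyap_curv C sigma2 (st k w).
have slp : bpast omega (sites_upto k) sl.
  rewrite /sl /lyap_slope; apply: bpastD => //.
  by apply: bpastM; [apply: bpastM => //|]; exact: bpast_cst.
have cup : bpast omega (sites_upto k) cu.
  by rewrite /cu /lyap_curv; apply: bpastM => //; exact: bpast_cst.
apply: (@Ex_step k _ _ (fun w => F w * (alive k w * sl w))
   (fun w => - 1 * (F w * (alive k w * cu w)))).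
- exact: bpastM.
- by apply: bpastM => //; exact: bpastM.
- by apply: bpastM; [exact: bpast_cst|apply: bpastM => //; exact: bpastM].
- by apply: bpastM; [exact: F_bpast|case: (lyap_past k.+1)].
move=> w; set p := psi _; set q := p ^+ 2 - sigma2.
rewrite (_ : _ + _ = F w * (lyap C sigma2 (st k w) + alive k w * sl w * p
  - alive k w * cu w * q)); last by ring.
apply: ler_wpM2l; first exact: F_ge0.
rewrite /alive /sl /cu; case: ifPn => [stp|nst].
  by rewrite !mul0r addr0 subr0 {1}/block_run /= /vstep -/(block_run k w) stp.
rewrite !mul1r; have [b1 b2 b3 b4 b5] := block_bounds k w.
exact: lyap_step.
Qed.

(** Seventy times the bound on the mean of [vsum] on success, so that Markov's inequality loses at
    most [1 / 70]. *)
Definition good_sum : R := 7 * (1 + B + 2 * DD).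

Definition block_good n (w : T) : R :=
  if (10 * h <= vpos (st n w)) && (vsum (st n w) <= good_sum) then 1 else 0.

Lemma block_good_bpast n : bpast omega (sites_upto n) (block_good n).
Proof.
have [i1 i2 i3 i4 i5] := block_run_past n.
apply: bpast_if; try exact: bpast_cst.
by apply: mpast_and; apply: mpast_le => //; exact: bpast_cst.
Qed.

(** Since [F] is an arbitrary nonnegative weight from the past, this bounds a conditional
    probability. Of the [5 / 66] given by [climb], at most [1 / 66] is still alive and at most
    [1 / 70] has too large a sum; the rest exceeds [1 / 22]. *)
Lemma Ex_block_good n : 66 * (121 * h ^+ 2) <= sigma2 * n%:R ->
  E F / 22 <= E (fun w => F w * block_good n w).
Proof.
move=> hn; have C4 := C_ge4; have hC := h_ge; have h0 : 0 < h by lra.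
have B0 := lyapB_gt0 C_ge4 sigma2_gt0; have D0 := lyapD_gt0 C_ge4 sigma2_gt0.
have [i1 i2 i3 i4 i5] := block_run_past n.
have EF0 : 0 <= E F by exact: Ex_ge0.
have Fn := F_bpast n.
have an := alive_bpast n; have rn := reached_bpast n.
have Fa := bpastM Fn an; have Fr := bpastM Fn rn.
have Frs := bpastM Fr i3; have Fg := bpastM Fn (block_good_bpast n).
have h1 : E (fun w => F w * alive n w) <= E F / 66.
  have := Ex_alive n.
  have : 0 <= E (fun w => F w * alive n w).
    by apply: Ex_ge0 => w; rewrite mulr_ge0// /alive; case: ifP.
  have : 0 < 121 * h ^+ 2 by rewrite mulr_gt0// exprn_gt0.
  nra.
(* On success [vpos - vmin >= 10 h], while [vmin >= - 2 h] controls the last term of [lyap]. *)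
have h2 : E (fun w => F w * reached n w * vsum (st n w)) <= E F * ((1 + B + 2 * DD) / 10).
  have [lk ek] := lyap_past n.
  have Fl := bpastM Fn lk.
  have le w : 10 * h * (F w * reached n w * vsum (st n w)) <=
      F w * lyap C sigma2 (st n w) + (B + 2 * DD * h) * F w.
    have -> : 10 * h * (F w * reached n w * vsum (st n w)) =
      F w * (reached n w * (10 * h * vsum (st n w))) by ring.
    rewrite [X in _ + X]mulrC -mulrDr ler_wpM2l//.
    have [b1 b2 b3 b4 b5] := block_bounds n w.
    have hr : reached n w * (10 * h * vsum (st n w)) <=
        vsum (st n w) * (vpos (st n w) - vmin (st n w) + (1 + C)).
      rewrite /reached; case: ifP => hv.
        by rewrite mul1r mulrC ler_wpM2l//; lra.
      by rewrite mul0r mulr_ge0//; lra.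
    have he : expR (- ((vpos (st n w) - vmin (st n w)) / 2)) <= 1.
      by rewrite -[leRHS](@expR0 R) ler_expR; lra.
    have hB : B * expR (- ((vpos (st n w) - vmin (st n w)) / 2)) <= B.
      by rewrite -[leRHS]mulr1 ler_pM2l.
    have hD : DD * vmin (st n w) >= - (2 * DD * h).
      by nra.
    by rewrite /lyap; lra.
  have c1 := bpastM (@bpast_cst _ _ _ _ omega (sites_upto n) (10 * h)) Frs.
  have c2 := bpastM (@bpast_cst _ _ _ _ omega (sites_upto n) (B + 2 * DD * h)) Fn.
  have := Ex_le c1 (bpastD Fl c2) le.
  rewrite (ExZ _ Frs) (ExD Fl c2) (ExZ _ Fn).
  have := Ex_lyap n => h3 h4.
  have h5 : 10 * h * E (fun w => F w * reached n w * vsum (st n w)) <=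
      h * (E F * (1 + B + 2 * DD)).
    apply: (le_trans h4).
    have BF : 0 <= B * E F by rewrite mulr_ge0// ltW.
    have h1' : 1 <= h by lra.
    have : B * E F <= h * (B * E F) by rewrite ler_peMl.
    have -> : h * (E F * (1 + B + 2 * DD)) = E F * h + h * (B * E F) + 2 * DD * h * E F.
      by ring.
    by rewrite mulrDl => h6; rewrite addrA lerD2r lerD.
  by rewrite -(ler_pM2l h0); lra.
have h3 : E (fun w => F w * climb h C (st n w)) <=
    E (fun w => F w * alive n w) + E (fun w => F w * reached n w).
  rewrite -(ExD Fa Fr); apply: (Ex_le (bpastM Fn (climb_past n)) (bpastD Fa Fr)).
  move=> w; rewrite -mulrDr ler_wpM2l//.
  have [b1 b2 b3 b4 b5] := block_bounds n w.
  have := climb_stopped_le h0 C_ge4 b4.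
  rewrite /alive /reached.
  by case: (stopped h (st n w)); case: (10 * h <= vpos (st n w))%R.
have h4 : E (fun w => F w * reached n w) - good_sum^-1 *
    E (fun w => F w * reached n w * vsum (st n w)) <= E (fun w => F w * block_good n w).
  have c1 := bpastM (@bpast_cst _ _ _ _ omega (sites_upto n) good_sum^-1) Frs.
  rewrite -(ExZ _ Frs) -(ExB Fr c1); apply: (Ex_le (bpastB Fr c1) Fg) => w.
  rewrite -mulrA mulrCA -mulrBr ler_wpM2l//.
  have [b1 b2 b3 b4 b5] := block_bounds n w.
  have K0 : 0 < good_sum by rewrite /good_sum; lra.
  rewrite /reached /block_good; case: ifP => //= _; last by rewrite mul0r mulr0 subr0.
  case: ifPn => [_|]; first by rewrite mul1r gerBl mulr_ge0// invr_ge0 ltW.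
  by rewrite -ltNge mul1r => hs; rewrite subr_le0 mulrC ler_pdivlMr// mul1r ltW.
have h5 : good_sum^-1 * E (fun w => F w * reached n w * vsum (st n w)) <= E F / 70.
  have K0 : 0 < good_sum by rewrite /good_sum; lra.
  rewrite mulrC ler_pdivrMr//; apply: le_trans h2 _.
  by rewrite /good_sum; lra.
have := Ex_climb n; lra.
Qed.

End valley_block.

(** * Quenched estimates by reversibility *)

Section integer_sums.
Context (R : realType).
Implicit Types (f g : int -> R) (a : int) (n : nat).

Definition isum a n f : R := \sum_(i < n) f (a + i%:Z).

Lemma isum_cat a m n f : isum a (m + n) f = isum a m f + isum (a + m%:Z) n f.
Proof.
rewrite /isum big_split_ord /=; congr (_ + _); apply: eq_bigr => i _.
by rewrite PoszD addrA.
Qed.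

Lemma isumSr a n f : isum a n.+1 f = isum a n f + f (a + n%:Z).
Proof. by rewrite /isum big_ord_recr. Qed.

Lemma isum_ge0 a n f : (forall x, 0 <= f x) -> 0 <= isum a n f.
Proof. by move=> f0; apply: sumr_ge0. Qed.

Lemma isum_le a n f g :
  (forall x, a <= x -> x < a + n%:Z -> f x <= g x) -> isum a n f <= isum a n g.
Proof.
move=> fg; apply: ler_sum => i _; apply: fg; first by rewrite lerDl.
by rewrite ltrD2l ltz_nat.
Qed.

Lemma eq_isum a n f g : (forall x, f x = g x) -> isum a n f = isum a n g.
Proof. by move=> fg; apply: eq_bigr. Qed.

Lemma isumD a n f g : isum a n (fun x => f x + g x) = isum a n f + isum a n g.
Proof. exact: big_split. Qed.

Lemma isumZ a n (c : R) f : isum a n (fun x => c * f x) = c * isum a n f.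
Proof. by rewrite /isum mulr_sumr. Qed.

Lemma isumB a n f g : isum a n (fun x => f x - g x) = isum a n f - isum a n g.
Proof. by rewrite /isum sumrB. Qed.

Lemma isum_shiftr a n f :
  isum a n (fun x => f (x + 1)) = isum a n f - f a + f (a + n%:Z).
Proof.
elim: n => [|n IH]; first by rewrite /isum !big_ord0 addr0 sub0r addNr.
rewrite !isumSr IH; have -> : a + n.+1%:Z = a + n%:Z + 1.
  by rewrite -addrA -PoszD addn1.
by ring.
Qed.

Lemma isum_shiftl a n f :
  isum a n (fun x => f (x - 1)) = isum a n f + f (a - 1) - f (a - 1 + n%:Z).
Proof.
have := isum_shiftr a n (fun x => f (x - 1)).
under eq_isum do rewrite addrK.
move=> ->; rewrite addrAC; have -> : a + n%:Z - 1 = a - 1 + n%:Z by rewrite addrAC.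
by ring.
Qed.

Lemma isum_sub a n a' n' f : (forall x, 0 <= f x) -> a <= a' ->
  a' + n'%:Z <= a + n%:Z -> isum a' n' f <= isum a n f.
Proof.
move=> f0 aa' nn'.
have [m mE] : exists m : nat, a' = a + m%:Z.
  exists (absz (a' - a)); rewrite gez0_abs; lia.
have [q qE] : exists q : nat, n = (m + n' + q)%N.
  by exists (n - (m + n'))%N; lia.
rewrite qE !isum_cat mE.
have := isum_ge0 a m f0; have := isum_ge0 (a + (m + n')%N%:Z) q f0; lra.
Qed.

Lemma isum_odd a q f : (forall x, 0 <= f x) ->
  \sum_(i < q) f (a + (i.*2.+1)%:Z) <= isum a q.*2 f.
Proof.
move=> f0; elim: q => [|q IH]; first by rewrite /isum !big_ord0.
rewrite big_ord_recr doubleS !isumSr /= -addrA lerD//.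
by rewrite lerDr.
Qed.

Lemma two_le_of_sqr_le (x y z : R) : 0 <= x -> 0 <= y -> z ^+ 2 <= x * y ->
  2 * z <= x + y.
Proof.
move=> x0 y0 zxy; rewrite leNgt; apply/negP => lt.
have : (x + y) ^+ 2 < (2 * z) ^+ 2.
  by rewrite ltr_pXn2r// nnegrE; lra.
have := sqr_ge0 (x - y); nra.
Qed.

(** Induction on [n], the cross term being controlled by the arithmetic-geometric mean
    inequality. *)
Lemma weighted_cauchy_schwarz n (u p : nat -> R) : (forall i, 0 < p i) ->
  (\sum_(i < n) u i) ^+ 2 <= (\sum_(i < n) u i ^+ 2 / p i) * \sum_(i < n) p i.
Proof.
move=> p0; elim: n => [|n IH]; first by rewrite !big_ord0 expr2 !mul0r.
rewrite !big_ord_recr /=.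
set S := \sum_(i < n) u i in IH *; set A := \sum_(i < n) u i ^+ 2 / p i in IH *.
set B := \sum_(i < n) p i in IH *.
have A0 : 0 <= A by apply: sumr_ge0 => i _; rewrite divr_ge0 ?sqr_ge0 ?ltW.
have B0 : 0 <= B by apply: sumr_ge0 => i _; exact: ltW.
have pn := p0 n; have pn' : p n != 0 by rewrite gt_eqF.
have : 2 * (S * u n) <= A * p n + u n ^+ 2 / p n * B.
  apply: two_le_of_sqr_le.
  - by rewrite mulr_ge0// ltW.
  - by rewrite mulr_ge0// divr_ge0 ?sqr_ge0 ?ltW.
  have -> : A * p n * (u n ^+ 2 / p n * B) = A * B * u n ^+ 2 by field.
  by rewrite exprMn ler_wpM2r ?sqr_ge0.
move=> h; have -> : (A + u n ^+ 2 / p n) * (B + p n) =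
  A * B + (A * p n + u n ^+ 2 / p n * B) + u n ^+ 2 by field.
by rewrite sqrrD; lra.
Qed.

End integer_sums.

(** * Transition probabilities in a fixed environment *)

Section quenched.
Context (R : realType) (e : int -> R).

Fixpoint pstep (n : nat) (x y : int) : R :=
  if n is k.+1 then e x * pstep k (x + 1) y + (1 - e x) * pstep k (x - 1) y
  else (x == y)%:R.

(** Splits off the last step, where the recursion defining [pstep] splits off the first. *)
Lemma pstep_forward n x y : pstep n.+1 x y =
  pstep n x (y - 1) * e (y - 1) + pstep n x (y + 1) * (1 - e (y + 1)).
Proof.
elim: n x y => [|n IH] x y.
  rewrite /=; case: (pselect (y = x + 1)) => [->|n1].
    rewrite addrK !eqxx; have -> : (x - 1 == x + 1) = false by apply/eqP; lia.
    have -> : (x == x + 1 + 1) = false by apply/eqP; lia.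
    by rewrite /=; ring.
  case: (pselect (y = x - 1)) => [->|n2].
    rewrite subrK !eqxx; have -> : (x + 1 == x - 1) = false by apply/eqP; lia.
    have -> : (x == x - 1 - 1) = false by apply/eqP; lia.
    by rewrite /=; ring.
  have -> : (x + 1 == y) = false by apply/eqP => h; apply: n1; lia.
  have -> : (x - 1 == y) = false by apply/eqP => h; apply: n2; lia.
  have -> : (x == y - 1) = false by apply/eqP => h; apply: n1; lia.
  have -> : (x == y + 1) = false by apply/eqP => h; apply: n2; lia.
  by rewrite /=; ring.
have S u v : pstep n.+1 u v = e u * pstep n (u + 1) v + (1 - e u) * pstep n (u - 1) v.
  by [].
rewrite -[LHS]/(e x * pstep n.+1 (x + 1) y + (1 - e x) * pstep n.+1 (x - 1) y).
by rewrite (S x (y - 1)) (S x (y + 1)) !IH; ring.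
Qed.

Context (W : int -> R) (eps : R).
Hypotheses (eps_gt0 : 0 < eps) (e_ge : forall x, eps <= e x)
  (e_le : forall x, e x <= 1 - eps)
  (W_gt0 : forall x, 0 < W x)
  (W_rec : forall x, W x * e x = (1 - e x) * W (x - 1)).

(* [(W x)^-1] is the conductance of the edge between [x] and [x + 1], and [revm]
   is the corresponding reversible measure. *)
Definition revm (x : int) : R := (W (x - 1))^-1 + (W x)^-1.

Lemma revm_gt0 x : 0 < revm x.
Proof. by rewrite addr_gt0 ?invr_gt0. Qed.

Lemma e_bounds x : 0 < e x < 1.
Proof. have := e_ge x; have := e_le x; have := eps_gt0; lra. Qed.

Lemma revm_r x : revm x * e x = (W x)^-1.
Proof.
have W1 : W (x - 1) != 0 by rewrite gt_eqF.
have W2 : W x != 0 by rewrite gt_eqF.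
apply: (mulfI W2); rewrite mulfV// /revm.
have -> : W x * (((W (x - 1))^-1 + (W x)^-1) * e x) = W x * e x / W (x - 1) + e x.
  by field; rewrite W1 W2.
by rewrite W_rec; field.
Qed.

Lemma revm_l x : revm x * (1 - e x) = (W (x - 1))^-1.
Proof. by rewrite mulrBr mulr1 revm_r /revm addrK. Qed.

Lemma pstep_ge0 n x y : 0 <= pstep n x y.
Proof.
elim: n x => [|n IH] x /=; first exact: ler0n.
by have /andP[a1 a2] := e_bounds x; rewrite addr_ge0 ?mulr_ge0//; lra.
Qed.

Lemma pstep_le1 n x y : pstep n x y <= 1.
Proof.
elim: n x => [|n IH] x /=; first by case: eqP.
have /andP[a1 a2] := e_bounds x.
have h1 : e x * pstep n (x + 1) y <= e x by rewrite ler_piMr// ltW.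
have h2 : (1 - e x) * pstep n (x - 1) y <= 1 - e x.
  by rewrite ler_piMr//; lra.
by lra.
Qed.

Lemma pstep_rev n x y : revm x * pstep n x y = revm y * pstep n y x.
Proof.
elim: n x y => [|n IH] x y.
  by rewrite /= [y == x]eq_sym; case: eqP => [->//|_]; rewrite !mulr0.
rewrite [in RHS]pstep_forward /= [revm x * _]mulrDr [revm y * _]mulrDr.
rewrite !mulrA revm_r revm_l.
rewrite -(IH (x - 1)) -(IH (x + 1)) (mulrAC (revm (x - 1))) revm_r.
by rewrite (mulrAC (revm (x + 1))) revm_l addrK addrC.
Qed.

Lemma pstep_far n (x y : int) : n%:Z < `|x - y| -> pstep n x y = 0.
Proof.
elim: n x => [|n IH] x /= h.
  by case: eqP => // xy; move: h; rewrite xy subrr normr0 ltxx.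
by rewrite !IH ?mulr0 ?addr0//; lia.
Qed.

(** Stands for the sum over all integers: [pstep] has finite range, so [M] is simply taken large
    enough. *)
Definition wsum M (f : int -> R) : R := isum (- M%:Z) M.*2.+1 f.

Lemma wsum_pstep0 M (x : int) (f : int -> R) : `|x| <= M%:Z ->
  wsum M (fun k => (x == k)%:R * f k) = f x.
Proof.
move=> xM; pose i : nat := absz (x + M%:Z).
have iE : i%:Z = x + M%:Z by rewrite gez0_abs; lia.
have iM : (i < M.*2.+1)%N by lia.
rewrite /wsum /isum (bigD1 (Ordinal iM))//= big1 ?addr0.
  have -> : - M%:Z + i%:Z = x by rewrite iE; lia.
  by rewrite eqxx mul1r.
move=> j /eqP ji; case: eqP => h; last by rewrite mul0r.
case: ji; apply: val_inj => /=; lia.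
Qed.

Lemma chapman_kolmogorov M i j (x y : int) : `|x| + i%:Z <= M%:Z ->
  pstep (i + j) x y = wsum M (fun k => pstep i x k * pstep j k y).
Proof.
elim: i x => [|i IH] x h /=.
  by rewrite wsum_pstep0//; lia.
rewrite !IH; try lia.
rewrite /wsum -!isumZ -isumD; apply: eq_isum => k; ring.
Qed.

Definition ret (b : int) (l : nat) : R := pstep l.*2 b b.

(** Reversibility turns [pstep i b x] into [pstep i x b], so return probabilities become inner
    products weighted by [revm]. *)
Lemma ret_sum M (b : int) i j : `|b| + i%:Z <= M%:Z ->
  revm b * pstep (i + j) b b =
  wsum M (fun x => revm x * (pstep i x b * pstep j x b)).
Proof.
move=> h; rewrite (chapman_kolmogorov j b h) /wsum -isumZ; apply: eq_isum => x.
by rewrite mulrA pstep_rev mulrA.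
Qed.

(** Invariance of [revm]; the vanishing boundary values of [g] remove the terms created by the two
    shifts. *)
Lemma wsum_revm_step M (g : int -> R) : g (- M%:Z) = 0 -> g (M%:Z) = 0 ->
  g (- M%:Z - 1) = 0 -> g (M%:Z + 1) = 0 ->
  wsum M (fun x => revm x * (e x * g (x + 1) + (1 - e x) * g (x - 1))) =
  wsum M (fun x => revm x * g x).
Proof.
move=> g1 g2 g3 g4.
pose A x := (W (x - 1))^-1 * g x; pose B x := (W x)^-1 * g x.
have -> : wsum M (fun x => revm x * (e x * g (x + 1) + (1 - e x) * g (x - 1))) =
    wsum M (fun x => A (x + 1) + B (x - 1)).
  apply: eq_isum => x; rewrite mulrDr !mulrA revm_r revm_l /A /B addrK.
  by [].
rewrite /wsum isumD isum_shiftr isum_shiftl.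
have -> : - M%:Z + (M.*2.+1)%:Z = M%:Z + 1 by lia.
have -> : - M%:Z - 1 + (M.*2.+1)%:Z = M%:Z by lia.
rewrite /A /B g1 g2 g3 g4 !mulr0 !subr0 !addr0 -isumD.
by apply: eq_isum => x; rewrite /revm mulrDl.
Qed.

(* The energy dissipated in one step is the conditional variance of
   [pstep l X_1 b]. *)
Lemma ret_energy M (b : int) l : `|b| + l.+1%:Z < M%:Z ->
  revm b * (ret b l - ret b l.+1) =
  wsum M (fun x => (1 - e x) / W x * (pstep l (x + 1) b - pstep l (x - 1) b) ^+ 2).
Proof.
move=> h; rewrite mulrBr /ret -!addnn !(@ret_sum M); try lia.
have -> : wsum M (fun x => revm x * (pstep l x b * pstep l x b)) =
    wsum M (fun x => revm x * (e x * pstep l (x + 1) b ^+ 2 +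
      (1 - e x) * pstep l (x - 1) b ^+ 2)).
  rewrite (@wsum_revm_step M (fun x => pstep l x b ^+ 2)).
  - by apply: eq_isum => x; rewrite expr2.
  - by rewrite pstep_far ?expr0n//; lia.
  - by rewrite pstep_far ?expr0n//; lia.
  - by rewrite pstep_far ?expr0n//; lia.
  - by rewrite pstep_far ?expr0n//; lia.
rewrite /wsum -isumB; apply: eq_isum => x /=.
rewrite -revm_r; ring.
Qed.

(** Split the time [2 (l + 1)] as [l + (l + 2)] and use [2 p q <= p ^ 2 + q ^ 2] under the sum. *)
Lemma ret_convex b l : 2 * ret b l.+1 <= ret b l + ret b l.+2.
Proof.
have p0 := revm_gt0 b; rewrite -(ler_pM2l p0) [leRHS]mulrDr.
pose M : nat := (absz b + l.+2)%N.
have rE k i j : (i + j)%N = k.*2 -> (i <= l.+2)%N -> revm b * ret b k =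
    wsum M (fun x => revm x * (pstep i x b * pstep j x b)).
  by move=> ij il; rewrite /ret -ij (@ret_sum M)//; rewrite /M; lia.
rewrite (mulrCA (revm b) 2) (rE l.+1 l l.+2) ?(rE l l l) ?(rE l.+2 l.+2 l.+2)//; try lia.
rewrite /wsum -isumZ -isumD; apply: isum_le => x _ _.
have := sqr_ge0 (pstep l x b - pstep l.+2 x b); have := revm_gt0 x.
by nra.
Qed.

(** By convexity the decrements are nonincreasing, and the first [l + 1] of them add up to at most
    [ret b 0 = 1]. *)
Lemma ret_decr b l : l.+1%:R * (ret b l - ret b l.+1) <= 1.
Proof.
have mono i j : (i <= j)%N -> ret b j - ret b j.+1 <= ret b i - ret b i.+1.
  elim: j => [|j IH]; first by rewrite leqn0 => /eqP ->.
  rewrite leq_eqVlt => /orP[/eqP ->//|ij].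
  by apply: le_trans (IH ij); have := ret_convex b j; lra.
have tele k : (k <= l.+1)%N -> k%:R * (ret b l - ret b l.+1) <= ret b 0 - ret b k.
  elim: k => [|k IH] kl; first by rewrite mul0r subrr.
  have := IH (ltnW kl); have := mono k l kl; rewrite -natr1 mulrDl mul1r; lra.
have r0 : ret b 0 = 1 by rewrite /ret /= eqxx.
have r1 : 0 <= ret b l.+1 by exact: pstep_ge0.
by have := tele _ (leqnn _); rewrite r0; lra.
Qed.

(** By reversibility each endpoint is occupied with probability at most [delta], so one step lets at
    most [2 * delta] of the mass escape. *)
Lemma mass_in_interval b a n (delta : R) : a <= b -> b < a + n.+1%:Z ->
  revm a <= delta * revm b -> revm (a + n%:Z) <= delta * revm b ->
  forall l, 1 - l%:R * (2 * delta) <= isum a n.+1 (pstep l b).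
Proof.
move=> ab bn ha hc.
have end_le x l : revm x <= delta * revm b -> pstep l b x <= delta.
  move=> hx; rewrite -(ler_pM2l (revm_gt0 b)) pstep_rev [leRHS]mulrC.
  apply: le_trans hx; rewrite ler_piMr ?pstep_le1// ltW//; exact: revm_gt0.
elim=> [|l IH].
  rewrite mul0r subr0.
  pose i : nat := absz (b - a).
  have iE : i%:Z = b - a by rewrite gez0_abs; lia.
  have iM : (i < n.+1)%N by lia.
  rewrite /isum (bigD1 (Ordinal iM))//=.
  have -> : a + i%:Z = b by rewrite iE; lia.
  by rewrite eqxx lerDl sumr_ge0.
have -> : isum a n.+1 (pstep l.+1 b) = isum a n.+1 (fun y =>
    pstep l b (y - 1) * e (y - 1) + pstep l b (y + 1) * (1 - e (y + 1))).
  by apply: eq_isum => y; exact: pstep_forward.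
rewrite isumD (isum_shiftr a n.+1 (fun y => pstep l b y * (1 - e y))).
rewrite (isum_shiftl a n.+1 (fun y => pstep l b y * e y)).
set S1 := isum _ _ _; set S2 := isum _ _ _.
have -> : S1 + pstep l b (a - 1) * e (a - 1) -
    pstep l b (a - 1 + n.+1%:Z) * e (a - 1 + n.+1%:Z) +
    (S2 - pstep l b a * (1 - e a) + pstep l b (a + n.+1%:Z) * (1 - e (a + n.+1%:Z)))
  = isum a n.+1 (pstep l b) + pstep l b (a - 1) * e (a - 1) +
    pstep l b (a + n.+1%:Z) * (1 - e (a + n.+1%:Z)) -
    pstep l b (a + n%:Z) * e (a + n%:Z) - pstep l b a * (1 - e a).
  have -> : isum a n.+1 (pstep l b) = S1 + S2.
    by rewrite -isumD; apply: eq_isum => y; ring.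
  have -> : a - 1 + n.+1%:Z = a + n%:Z by lia.
  by ring.
have eb := e_bounds.
have t1 : 0 <= pstep l b (a - 1) * e (a - 1).
  by rewrite mulr_ge0 ?pstep_ge0//; have := eb (a - 1); lra.
have t2 : 0 <= pstep l b (a + n.+1%:Z) * (1 - e (a + n.+1%:Z)).
  by rewrite mulr_ge0 ?pstep_ge0//; have := eb (a + n.+1%:Z); lra.
have t3 : pstep l b (a + n%:Z) * e (a + n%:Z) <= delta.
  apply: le_trans (end_le _ l hc); rewrite ler_piMr ?pstep_ge0//.
  by have := eb (a + n%:Z); lra.
have t4 : pstep l b a * (1 - e a) <= delta.
  apply: le_trans (end_le _ l ha); rewrite ler_piMr ?pstep_ge0//.
  by have := eb a; lra.
by rewrite -natr1 mulrDl mul1r; lra.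
Qed.

(* Cauchy-Schwarz against the reversible measure: [ret] cannot be small as long
   as the walk started at [b] is still in an interval of comparable mass. *)
Lemma ret_lower b a n (delta K : R) l : a <= b -> b < a + n.+1%:Z ->
  revm a <= delta * revm b -> revm (a + n%:Z) <= delta * revm b ->
  isum a n.+1 revm <= K * revm b ->
  4 * l%:R * delta <= 1 -> 1 <= 4 * K * ret b l.
Proof.
move=> ab bn ha hc hK hl.
have mass := mass_in_interval ab bn ha hc l.
have pb := revm_gt0 b.
pose M : nat := (absz b + l + absz a + n.+1)%N.
have retE : revm b * ret b l =
    wsum M (fun x => revm x * (pstep l x b * pstep l x b)).
  by rewrite /ret -addnn (@ret_sum M)//; rewrite /M; lia.
have cs : isum a n.+1 (pstep l b) ^+ 2 <=
    isum a n.+1 (fun x => pstep l b x ^+ 2 / revm x) * isum a n.+1 revm.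
  exact: (@weighted_cauchy_schwarz R n.+1 (fun i => pstep l b (a + i%:Z))
    (fun i => revm (a + i%:Z)) (fun i => revm_gt0 _)).
have sq : isum a n.+1 (fun x => pstep l b x ^+ 2 / revm x) * revm b <= ret b l.
  rewrite -(ler_pM2l pb) retE.
  have -> : revm b * (isum a n.+1 (fun x => pstep l b x ^+ 2 / revm x) * revm b) =
      isum a n.+1 (fun x => revm x * (pstep l x b * pstep l x b)).
    rewrite mulrCA mulrC -expr2 -isumZ; apply: eq_isum => x.
    have px := revm_gt0 x; have px' : revm x != 0 by rewrite gt_eqF.
    have -> : revm b ^+ 2 * (pstep l b x ^+ 2 / revm x) =
      (revm b * pstep l b x) ^+ 2 / revm x by rewrite exprMn mulrA.
    by rewrite pstep_rev; field.
  apply: isum_sub; last 2 first.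
  - by rewrite /M; lia.
  - by rewrite /M; lia.
  by move=> x; rewrite mulr_ge0 ?mulr_ge0 ?pstep_ge0// ltW// revm_gt0.
have r0 : 0 <= ret b l by exact: pstep_ge0.
have mass' : 2^-1 <= isum a n.+1 (pstep l b) by apply: le_trans mass; lra.
have : (2^-1 : R) ^+ 2 <= isum a n.+1 (pstep l b) ^+ 2.
  by rewrite ler_pXn2r// nnegrE; lra.
set A := isum a n.+1 (fun x => pstep l b x ^+ 2 / revm x) in sq cs *.
set N := isum a n.+1 revm in hK cs *.
have A0 : 0 <= A.
  by apply: isum_ge0 => x; rewrite divr_ge0 ?sqr_ge0// ltW// revm_gt0.
have AN : A * N <= K * ret b l.
  apply: (@le_trans _ _ (A * (K * revm b))); first exact: ler_wpM2l.
  rewrite mulrCA; have K0 : 0 <= K.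
    rewrite -(pmulr_lge0 _ pb); apply: le_trans hK; apply: isum_ge0 => x.
    exact/ltW/revm_gt0.
  exact: ler_wpM2l.
have -> : (2^-1 : R) ^+ 2 = 4^-1 by rewrite expr2; field.
by move=> h; have := le_trans h cs; lra.
Qed.

(** Cauchy-Schwarz along the path: energy from [ret_energy] times the resistance, the sum of [W].
    The path advances by two sites because the energy compares [x - 1] with [x + 1], and [eps]
    bounds [1 - e] from below. *)
Lemma pstep_even_diff b x q l :
  (pstep l (x + (q.*2)%:Z) b - pstep l x b) ^+ 2 <=
    revm b * (ret b l - ret b l.+1) / eps * isum x q.*2 W.
Proof.
pose M : nat := (absz b + l.+2 + absz x + q.*2)%N.
pose u i := pstep l (x + (i.+1.*2)%:Z) b - pstep l (x + (i.*2)%:Z) b.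
have tele : pstep l (x + (q.*2)%:Z) b - pstep l x b = \sum_(i < q) u i.
  elim: q {M} => [|q IH]; first by rewrite big_ord0 addr0 subrr.
  by rewrite big_ord_recr /= -IH /u addrC subrKA.
have cs := @weighted_cauchy_schwarz R q u (fun i => W (x + (i.*2.+1)%:Z))
  (fun i => W_gt0 _).
rewrite tele; apply: (le_trans cs); apply: ler_pM.
- by apply: sumr_ge0 => i _; rewrite divr_ge0 ?sqr_ge0 ?ltW.
- by apply: sumr_ge0 => i _; rewrite ltW.
- rewrite ler_pdivlMr// mulrC (@ret_energy M); last by rewrite /M; lia.
  pose G y := (1 - e y) / W y * (pstep l (y + 1) b - pstep l (y - 1) b) ^+ 2.
  have G0 y : 0 <= G y.
    rewrite mulr_ge0 ?sqr_ge0// divr_ge0 ?ltW//.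
    by have := e_bounds y; lra.
  have h1 : eps * \sum_(i < q) u i ^+ 2 / W (x + (i.*2.+1)%:Z) <=
      \sum_(i < q) G (x + (i.*2.+1)%:Z).
    rewrite mulr_sumr; apply: ler_sum => i _; rewrite /G /u.
    have -> : x + (i.*2.+1)%:Z + 1 = x + (i.+1.*2)%:Z by lia.
    have -> : x + (i.*2.+1)%:Z - 1 = x + (i.*2)%:Z by lia.
    rewrite mulrCA mulrC ler_wpM2r ?sqr_ge0// ler_pM2r ?invr_gt0//.
    by have := e_le (x + (i.*2.+1)%:Z); lra.
  apply: (le_trans h1); apply: (le_trans (isum_odd x q G0)).
  by apply: isum_sub => //; rewrite /M; lia.
- by apply: isum_odd => y; exact: ltW.
Qed.

(** At [b] itself [ret_lower] gives [1 / (4 K)]. Changing the starting point to [y] costs at most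
    [1 / (8 K)]: the squared difference is at most energy times resistance, and [ret_decr] makes the
    energy small. *)
Lemma pstep_lower_even b a n (delta K r : R) j y :
  a <= b -> b < a + n.+1%:Z ->
  revm a <= delta * revm b -> revm (a + n%:Z) <= delta * revm b ->
  isum a n.+1 revm <= K * revm b ->
  4 * j%:R * delta <= 1 ->
  (exists q : nat, (y = b + (q.*2)%:Z /\ isum b q.*2 W <= r) \/
    (b = y + (q.*2)%:Z /\ isum y q.*2 W <= r)) ->
  64 * K ^+ 2 * (revm b * r) <= eps * (j.*2.+1)%:R ->
  1 <= 8 * K * pstep j.*2 y b.
Proof.
move=> ab bn ha hc hK hj [q hq] hr.
have low := ret_lower ab bn ha hc hK hj.
have pb := revm_gt0 b.
have K0 : 0 < K.
  rewrite -(pmulr_lgt0 _ pb); apply: lt_le_trans hK.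
  rewrite isumSr ltr_wpDl ?revm_gt0//; apply: isum_ge0 => x; exact/ltW/revm_gt0.
(* [ret b j] is [pstep l b b], while the energy of [pstep l] is a decrement of [ret] at [l], that is
   at time [4 j]. *)
set l := j.*2.
have dl : 0 <= ret b l - ret b l.+1.
  rewrite -(pmulr_rge0 _ pb) (@ret_energy (absz b + l.+2)%N); last by lia.
  apply: isum_ge0 => x; rewrite mulr_ge0 ?sqr_ge0// divr_ge0 ?ltW//.
  by have := e_bounds x; lra.
have diff : (pstep l y b - ret b j) ^+ 2 <=
    revm b * (ret b l - ret b l.+1) / eps * r.
  have c0 : 0 <= revm b * (ret b l - ret b l.+1) / eps.
    by apply: divr_ge0; [apply: mulr_ge0 => //; exact: ltW|exact: ltW].
  case: hq => [[yE hr']|[bE hr']].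
    rewrite yE; apply: le_trans (pstep_even_diff _ _ _ _) _.
    exact: ler_wpM2l.
  rewrite -sqrrN opprB; apply: (@le_trans _ _
    (revm b * (ret b l - ret b l.+1) / eps * isum y q.*2 W)); last exact: ler_wpM2l.
  have -> : ret b j = pstep l (y + (q.*2)%:Z) b by rewrite -bE.
  exact: pstep_even_diff.
have r0 : 0 <= r.
  by case: hq => -[_]; apply: le_trans; apply: isum_ge0 => x; exact: ltW.
have dec := ret_decr b l.
have l0 : 0 < l.+1%:R :> R by rewrite ltr0n.
have sm : 64 * K ^+ 2 * (pstep l y b - ret b j) ^+ 2 <= 1.
  have h1 : 64 * K ^+ 2 * (pstep l y b - ret b j) ^+ 2 <=
      64 * K ^+ 2 * (revm b * (ret b l - ret b l.+1) / eps * r).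
    by rewrite ler_pM2l// mulr_gt0// exprn_gt0.
  apply: (le_trans h1).
  have -> : 64 * K ^+ 2 * (revm b * (ret b l - ret b l.+1) / eps * r) =
    64 * K ^+ 2 * (revm b * r) * ((ret b l - ret b l.+1) / eps) by ring.
  apply: (@le_trans _ _ (eps * l.+1%:R * ((ret b l - ret b l.+1) / eps))).
    by rewrite ler_wpM2r// divr_ge0// ltW.
  have -> : eps * l.+1%:R * ((ret b l - ret b l.+1) / eps) =
    l.+1%:R * (ret b l - ret b l.+1) by field; rewrite gt_eqF.
  exact: dec.
have : (8 * K * (ret b j - pstep l y b)) ^+ 2 <= 1 ^+ 2.
  have -> : (8 * K * (ret b j - pstep l y b)) ^+ 2 =
    64 * K ^+ 2 * (pstep l y b - ret b j) ^+ 2 by ring.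
  by rewrite expr1n.
case: (lerP 0 (8 * K * (ret b j - pstep l y b))) => sg.
  by rewrite ler_pXn2r ?nnegrE// => h; lra.
by move=> _; lra.
Qed.

(** Each step changes the parity of the position, so [b] is accessible only at every other time. *)
Definition meeting_site (b : int) (n : nat) (y : int) : int :=
  if (2 %| y + n%:Z - b)%Z then b else b + 1.

Section meeting.
Context (a b : int) (m X : nat) (delta K r : R).
Hypotheses (ab : a <= b) (bm : b < a + m.+1%:Z)
  (revm_left : revm a <= delta * revm b)
  (revm_right : revm (a + m%:Z) <= delta * revm b)
  (revm_sum : isum a m.+1 revm <= K * revm b)
  (barrier : forall (y : int) q, - X%:Z <= y -> y <= X%:Z ->
    (y = b + q%:Z -> isum b q W <= r) /\ (b = y + q%:Z -> isum y q W <= r)).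

(** For odd [n] the first step goes to [y + 1], at cost [eps], and leaves an even time; this is why
    [y + 1 <= X] is assumed. *)
Lemma pstep_lower_same n y : - X%:Z <= y -> y + 1 <= X%:Z ->
  2 * n%:R * delta <= 1 -> 64 * K ^+ 2 * (revm b * r) <= eps * n%:R ->
  (2 %| y + n%:Z - b)%Z -> eps <= 8 * K * pstep n y b.
Proof.
move=> yl yr hn hr dv.
have d0 : 0 <= delta.
  by rewrite -(pmulr_lge0 _ (revm_gt0 b)); apply: le_trans revm_left; exact/ltW/revm_gt0.
have K0 : 0 <= K.
  rewrite -(pmulr_lge0 _ (revm_gt0 b)); apply: le_trans revm_sum.
  by apply: isum_ge0 => x; exact/ltW/revm_gt0.
have eps1 : eps <= 1 by have := e_ge 0; have := e_le 0; have := eps_gt0; lra.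
have bar y' : - X%:Z <= y' -> y' <= X%:Z -> (2 %| y' - b)%Z ->
  exists q : nat, (y' = b + (q.*2)%:Z /\ isum b q.*2 W <= r) \/
    (b = y' + (q.*2)%:Z /\ isum y' q.*2 W <= r).
  move=> l1 l2 /dvdzP [k kE]; exists (absz k); have [b1 b2] := barrier (absz k).*2 l1 l2.
  case: (lerP 0 k) => k0.
    have yE : y' = b + (absz k).*2%:Z by lia.
    by left; split => //; exact: b1.
  have yE : b = y' + (absz k).*2%:Z by lia.
  by right; split => //; exact: b2.
have low j y' : - X%:Z <= y' -> y' <= X%:Z -> (2 %| y' - b)%Z -> (j.*2 <= n)%N ->
    (n <= j.*2.+1)%N -> 1 <= 8 * K * pstep j.*2 y' b.
  move=> l1 l2 dv' jn nj.
  apply: (pstep_lower_even ab bm revm_left revm_right revm_sum _ (bar _ l1 l2 dv')).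
    apply: le_trans hn; rewrite ler_wpM2r//.
    have : j.*2%:R <= n%:R :> R by rewrite ler_nat.
    by rewrite -muln2 natrM; lra.
  by apply: (le_trans hr); rewrite ler_pM2l// ler_nat.
have nE := odd_double_half n; case: (odd n) in nE.
- have le1 : 1 <= 8 * K * pstep n./2.*2 (y + 1) b.
    by apply: low; lia.
  have := e_ge y => ey.
  rewrite -nE add1n /=.
  have p1 := pstep_ge0 n./2.*2 (y + 1) b; have p2 := pstep_ge0 n./2.*2 (y - 1) b.
  have h1 : eps * pstep n./2.*2 (y + 1) b <= e y * pstep n./2.*2 (y + 1) b.
    by rewrite ler_wpM2r.
  have h2 : 0 <= (1 - e y) * pstep n./2.*2 (y - 1) b.
    by rewrite mulr_ge0//; have := e_bounds y; lra.
  apply: (@le_trans _ _ (8 * K * (eps * pstep n./2.*2 (y + 1) b))).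
    by rewrite mulrCA -[leLHS]mulr1 ler_pM2l.
  by rewrite ler_wpM2l ?mulr_ge0//; lra.
- rewrite -nE add0n; apply: (le_trans eps1); apply: low; lia.
Qed.

(** At the other parity, the walk is at [b] at time [n - 1] and then steps to [b + 1]; hence the
    second factor [eps] and the [n.-1]. *)
Lemma pstep_lower n y : (0 < n)%N -> - X%:Z <= y -> y + 1 <= X%:Z ->
  2 * n%:R * delta <= 1 -> 64 * K ^+ 2 * (revm b * r) <= eps * n.-1%:R ->
  eps ^+ 2 <= 8 * K * pstep n y (meeting_site b n y).
Proof.
move=> n0 yl yr hn hr; rewrite /meeting_site.
have eps1 : eps <= 1 by have := e_ge 0; have := e_le 0; have := eps_gt0; lra.
have d0 : 0 <= delta.
  by rewrite -(pmulr_lge0 _ (revm_gt0 b)); apply: le_trans revm_left; exact/ltW/revm_gt0.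
have K0 : 0 <= K.
  rewrite -(pmulr_lge0 _ (revm_gt0 b)); apply: le_trans revm_sum.
  by apply: isum_ge0 => x; exact/ltW/revm_gt0.
case: ifPn => dv.
  apply: (@le_trans _ _ eps); first by rewrite expr2 ler_piMr// ltW.
  apply: pstep_lower_same => //; apply: (le_trans hr).
  by rewrite ler_pM2l// ler_nat leq_pred.
have nE : n = n.-1.+1 by rewrite prednK.
have hs : eps <= 8 * K * pstep n.-1 y b.
  apply: pstep_lower_same => //; last by lia.
  by apply: le_trans hn; rewrite ler_wpM2r// ler_pM2l// ler_nat leq_pred.
rewrite nE pstep_forward addrK.
have p1 := pstep_ge0 n.-1 y b; have p2 := pstep_ge0 n.-1 y (b + 1 + 1).
have h2 : 0 <= pstep n.-1 y (b + 1 + 1) * (1 - e (b + 1 + 1)).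
  by rewrite mulr_ge0//; have := e_bounds (b + 1 + 1); lra.
have h1 : pstep n.-1 y b * eps <= pstep n.-1 y b * e b by rewrite ler_wpM2l.
apply: (@le_trans _ _ (8 * K * (pstep n.-1 y b * eps))).
  by rewrite mulrA expr2 ler_pM2r.
by rewrite ler_wpM2l ?mulr_ge0//; lra.
Qed.

End meeting.

End quenched.

(** * From good blocks to valleys *)

Section potential.
Context (R : realType) (xi : int -> R).

(** Normalised to vanish at 0, with increment [xi z] from [z - 1] to [z] on both sides; [Negz n] is
    [- (n + 1)]. *)
Definition potential (z : int) : R :=
  match z with
  | Posz n => \sum_(i < n) xi (i.+1)%:Z
  | Negz n => - \sum_(i < n.+1) xi (- i%:Z)
  end.
Local Notation V := potential.

Lemma potentialS z : V (z + 1) = V z + xi (z + 1).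
Proof.
case: z => [n|[|n]].
- by rewrite -PoszD addn1 /= big_ord_recr.
- have -> : Negz 0 + 1 = 0 by [].
  by rewrite /= big_ord0 big_ord1 oppr0 addNr.
- have -> : Negz n.+1 + 1 = Negz n by lia.
  rewrite /= [in RHS]big_ord_recr /=.
  have -> : Negz n = - n.+1%:Z by lia.
  by ring.
Qed.

Lemma potential_right x i : V (x + i%:Z) - V x = partial_sum (fun k => xi (x + k.+1%:Z)) i.
Proof.
elim: i => [|i IH]; first by rewrite addr0 subrr partial_sum0.
rewrite partial_sumS -IH; have -> : x + i.+1%:Z = x + i%:Z + 1 by lia.
by rewrite potentialS addrAC.
Qed.

Lemma potential_left x i : V (x - i%:Z) - V x = partial_sum (fun k => - xi (x - k%:Z)) i.
Proof.
elim: i => [|i IH]; first by rewrite subr0 subrr partial_sum0.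
rewrite partial_sumS -IH; have := potentialS (x - i.+1%:Z).
have -> : x - i.+1%:Z + 1 = x - i%:Z by lia.
by move=> ->; ring.
Qed.

Lemma potential_lip (C : R) x q : (forall z, `|xi z| <= C) ->
  `|V (x + q%:Z) - V x| <= C * q%:R.
Proof.
move=> xiC; rewrite potential_right /partial_sum.
apply: (le_trans (ler_norm_sum _ _ _)).
apply: (@le_trans _ _ (\sum_(i < q) C)); first exact: ler_sum.
by rewrite sumr_const card_ord mulr_natr.
Qed.

End potential.

Section gluing.
Context (R : realType) (xi : int -> R) (C h G s0 : R) (x0 n : nat).
Local Notation V := (potential xi).
Local Notation W := (fun z => expR (V z)).
Local Notation x0R := (x0%:R : R).
Hypotheses (C_gt0 : 0 < C) (xi_le : forall z, `|xi z| <= C) (h_gt0 : 0 < h)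
  (s0E : s0 = (x0.*2.+1)%:R * expR (2 * C * x0%:R)).
Let xiR (k : nat) := xi (x0%:Z + k.+1%:Z).
Let xiL (k : nat) := - xi (- x0%:Z - k%:Z).
Hypotheses (highR : 10 * h <= vpos (vrun h s0 xiR n))
  (sumR : vsum (vrun h s0 xiR n) <= G)
  (highL : 10 * h <= vpos (vrun h s0 xiL n))
  (sumL : vsum (vrun h s0 xiL n) <= G).

Lemma potential_mid z : - x0%:Z <= z -> z <= x0%:Z ->
  [/\ - (C * x0%:R) <= V z, V z <= C * x0%:R & V x0%:Z - 2 * C * x0%:R <= V z].
Proof.
move=> zl zr.
have V0 : V 0 = 0 by rewrite -[V 0]/(V (Posz 0)) /= big_ord0.
have Vx : `|V x0%:Z - V z| <= 2 * C * x0%:R.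
  pose q := absz (x0%:Z - z).
  have -> : x0%:Z = z + q%:Z by rewrite /q; lia.
  apply: (le_trans (potential_lip z q xi_le)).
  rewrite [2 * C]mulrC -mulrA ler_pM2l// -natrM ler_nat /q; lia.
have Vz : `|V z| <= C * x0%:R.
  case: (lerP 0 z) => z0.
    have {1}-> : z = 0 + (absz z)%:Z by lia.
    have := potential_lip 0 (absz z) xi_le; rewrite V0 subr0 => h1.
    apply: (le_trans h1); rewrite ler_pM2l// ler_nat; lia.
  have := potential_lip z (absz z) xi_le.
  have -> : z + absz z = 0 by lia.
  rewrite V0 sub0r normrN => h1.
  by apply: (le_trans h1); rewrite ler_pM2l// ler_nat; lia.
move: Vz Vx; rewrite !ler_norml => /andP[a1 a2] /andP[a3 a4]; split => //; lra.
Qed.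

(** The bottom [b] is the lower of the minima of the two blocks, and the valley extends to the
    points where each block reached height [10h]. Each block stays below [5h] before its minimum,
    which bounds the barrier from the explored middle to [b]. *)
Lemma valley_exists : exists (a b : int) (m : nat),
  [/\ a <= b, b < a + m.+1%:Z & (m <= (x0 + n).*2)%N] /\
  [/\ 10 * h - C * x0%:R <= V a, 10 * h - C * x0%:R <= V (a + m%:Z),
      - h - C * x0%:R <= V b & V b <= C * x0%:R] /\
  (isum a m.+1 (fun z => (W z)^-1) <= 2 * G / W b) /\
  (forall (y : int) q, - x0%:Z <= y -> y <= x0%:Z ->
    (y = b + q%:Z -> isum b q W <= ((x0 + n).*2.+1)%:R * expR (5 * h + C * x0%:R)) /\
    (b = y + q%:Z -> isum y q W <= ((x0 + n).*2.+1)%:R * expR (5 * h + C * x0%:R))).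
Proof.
have i1 : - x0%:Z <= x0%:Z by clear; lia.
have i2 : - x0%:Z <= - x0%:Z by [].
have i3 : x0%:Z <= x0%:Z by [].
have [r1 r2 r3] := potential_mid i1 i3.
have [l1 l2 l3] := potential_mid i2 i1.
have [TR [jR [[/andP[jTR TRn] SR minR lowR upR] sR]]] := vrun_success h_gt0 highR.
have [TL [jL [[/andP[jTL TLn] SL minL lowL upL] sL]]] := vrun_success h_gt0 highL.
have RE i : partial_sum xiR i = V (x0%:Z + i%:Z) - V x0%:Z.
  by rewrite potential_right.
have LE i : partial_sum xiL i = V (- x0%:Z - i%:Z) - V (- x0%:Z).
  by rewrite potential_left.
have S0R : partial_sum xiR jR <= 0.
  by rewrite -(partial_sum0 xiR); apply: minR.
have S0L : partial_sum xiL jL <= 0.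
  by rewrite -(partial_sum0 xiL); apply: minL.
pose bR := x0%:Z + jR%:Z; pose bL := - x0%:Z - jL%:Z.
pose b := if V bR <= V bL then bR else bL.
have VbR : V b <= V bR by rewrite /b; case: (lerP (V bR)) => // /ltW.
have VbL : V b <= V bL by rewrite /b; case: (lerP (V bR)) => // /ltW.
have onR i : (i <= TR)%N -> V bR <= V (x0%:Z + i%:Z).
  by move=> /minR; rewrite !RE; lra.
have onL i : (i <= TL)%N -> V bL <= V (- x0%:Z - i%:Z).
  by move=> /minL; rewrite !LE; lra.
exists (- x0%:Z - TL%:Z), b, (TL + x0.*2 + TR)%N.
have bin : - x0%:Z - jL%:Z <= b <= x0%:Z + jR%:Z.
  by rewrite /b; case: ifP => _; rewrite /bR /bL; clear; lia.
move: (bin) => /andP[bin1 bin2].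
split.
  by split; [clear - bin1 jTL; lia|clear - bin2 jTR; lia|clear - TRn TLn; lia].
have cE : - x0%:Z - TL%:Z + (TL + x0.*2 + TR)%N%:Z = x0%:Z + TR%:Z by clear; lia.
split.
  split.
  - by move: SL; rewrite LE; lra.
  - by rewrite cE; move: SR; rewrite RE; lra.
  - rewrite /b; case: ifP => _; first by move: lowR; rewrite RE /bR; lra.
    by move: lowL; rewrite LE /bL; lra.
  - by move: S0R; rewrite RE -/bR; lra.
split.
  have -> : (TL + x0.*2 + TR).+1 = (TL + (x0.*2.+1 + TR))%N by clear; lia.
  rewrite !isum_cat.
  have Wb : 0 < W b by exact: expR_gt0.
  have WV z z' : (W z)^-1 = expR (V z' - V z) * (W z')^-1.
    by rewrite -!expRN -expRD; congr expR; ring.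
  have left_le : isum (- x0%:Z - TL%:Z) TL (fun z => (W z)^-1) <=
      (\sum_(1 <= i < TL.+1) expR (- (partial_sum xiL i - partial_sum xiL jL))) / W b.
    rewrite mulr_suml big_add1 /= big_mkord /isum.
    rewrite (reindex_inj rev_ord_inj) /=; apply: ler_sum => i _.
    rewrite (WV _ b) ler_pM2r ?invr_gt0// ler_expR !LE.
    have -> : - x0%:Z - TL%:Z + (TL - i.+1)%N%:Z = - x0%:Z - i.+1%:Z.
      by have := ltn_ord i; clear; lia.
    by move: VbL; rewrite /bL; lra.
  have right_le : isum (- x0%:Z - TL%:Z + TL%:Z + (x0.*2.+1)%:Z) TR
        (fun z => (W z)^-1) <=
      (\sum_(1 <= i < TR.+1) expR (- (partial_sum xiR i - partial_sum xiR jR))) / W b.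
    rewrite mulr_suml big_add1 /= big_mkord /isum; apply: ler_sum => i _.
    rewrite (WV _ b) ler_pM2r ?invr_gt0// ler_expR !RE.
    have -> : - x0%:Z - TL%:Z + TL%:Z + (x0.*2.+1)%:Z + i%:Z = x0%:Z + i.+1%:Z by clear; lia.
    by move: VbR; rewrite /bR; lra.
  (* Each of the [2 x0 + 1] middle sites lies at most [2 C x0] below [V x0]. This mass is charged to
     the right block, through [s0]. *)
  have mid_le : isum (- x0%:Z - TL%:Z + TL%:Z) x0.*2.+1 (fun z => (W z)^-1) <=
      s0 * expR (partial_sum xiR jR) / W b.
    apply: (@le_trans _ _ (isum (- x0%:Z - TL%:Z + TL%:Z) x0.*2.+1
      (fun=> expR (2 * C * x0R) * expR (partial_sum xiR jR) / W b))).
      apply: isum_le => z z1 z2; rewrite (WV _ b) ler_pM2r ?invr_gt0//.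
      rewrite -expRD ler_expR RE.
      have z3 : - x0%:Z <= z by clear - z1; lia.
      have z4 : z <= x0%:Z by clear - z2; lia.
      have [m1 m2 m3] := potential_mid z3 z4.
      by move: VbR; rewrite /bR; lra.
    rewrite /isum sumr_const card_ord s0E -[leLHS]mulr_natl !mulrA.
    by [].
  have Gle : s0 * expR (partial_sum xiL jL) >= 0.
    by rewrite s0E !mulr_ge0 ?expR_ge0// ler0n.
  have -> : 2 * G / W b = G / W b + G / W b by ring.
  apply: (@le_trans _ _ ((vsum (vrun h s0 xiL n)) / W b +
    (vsum (vrun h s0 xiR n)) / W b)).
    rewrite -sR -sL !mulrDl addrA addrA.
    have : 0 <= s0 * expR (partial_sum xiL jL) / W b by rewrite divr_ge0// ltW.
    lra.
  by rewrite lerD// ler_pM2r ?invr_gt0.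
have sumW y q : (q <= (x0 + n).*2.+1)%N ->
    (forall z, y <= z -> z < y + q%:Z -> V z <= 5 * h + C * x0R) ->
    isum y q W <= ((x0 + n).*2.+1)%:R * expR (5 * h + C * x0R).
  move=> qn Vle.
  apply: (@le_trans _ _ (isum y q (fun=> expR (5 * h + C * x0R)))).
    by apply: isum_le => z z1 z2; rewrite ler_expR; exact: Vle.
  rewrite /isum sumr_const card_ord -[leLHS]mulr_natl ler_wpM2r ?expR_ge0//.
  by rewrite ler_nat.
have midV z : - x0%:Z <= z -> z <= x0%:Z -> V z <= 5 * h + C * x0R.
  by move=> z1 z2; have [_ m _] := potential_mid z1 z2; have := h_gt0; lra.
have rightV z : x0%:Z <= z -> z <= x0%:Z + jR%:Z -> V z <= 5 * h + C * x0R.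
  move=> z1 z2; pose i := absz (z - x0%:Z).
  have zE : z = x0%:Z + i%:Z by rewrite /i; clear - z1; lia.
  have : (i <= jR)%N by rewrite /i; clear - z1 z2; lia.
  by move=> /upR; rewrite RE -zE; lra.
have leftV z : - x0%:Z - jL%:Z <= z -> z <= - x0%:Z -> V z <= 5 * h + C * x0R.
  move=> z1 z2; pose i := absz (- x0%:Z - z).
  have zE : z = - x0%:Z - i%:Z by rewrite /i; clear - z2; lia.
  have : (i <= jL)%N by rewrite /i; clear - z1 z2; lia.
  by move=> /upL; rewrite LE -zE; lra.
have allV z : - x0%:Z - jL%:Z <= z -> z <= x0%:Z + jR%:Z -> V z <= 5 * h + C * x0R.
  move=> z1 z2; case: (lerP x0%:Z z) => z3; first exact: rightV.
  case: (lerP z (- x0%:Z)) => z4; [exact: leftV|].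
  by apply: midV; [clear - z4; lia|clear - z3; lia].
move=> y q y1 y2; split => E; apply: sumW.
- by clear - y2 E bin1 jTL TLn; lia.
- by move=> z z1 z2; apply: allV; [clear - z1 bin1|clear - z2 y2 E]; lia.
- by clear - y1 E bin2 jTR TRn; lia.
- by move=> z z1 z2; apply: allV; [clear - z1 y1|clear - z2 E bin2]; lia.
Qed.

End gluing.

(** * Choice of the scale and of the time window *)

Section scales.
Context (R : realType).

Lemma ln_le_harmonic (n1 N : nat) : (0 < n1)%N -> (n1 <= N)%N ->
  ln (N%:R : R) - ln n1%:R <= \sum_(n1 <= t < N) t%:R^-1.
Proof.
move=> n0; elim: N => [|N IH]; first by rewrite leqn0 => /eqP n00; rewrite n00 in n0.
rewrite leq_eqVlt => /orP[/eqP <-|nN]; first by rewrite subrr big_geq.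
rewrite big_nat_recr//=.
have N0 : 0 < N%:R :> R by rewrite ltr0n (leq_trans n0).
have -> : N.+1%:R = N%:R * (1 + N%:R^-1) :> R.
  by rewrite mulrDr mulfV ?gt_eqF// mulr1 natr1.
have i0 : 0 < N%:R^-1 :> R by rewrite invr_gt0.
rewrite lnM; [|by rewrite posrE|by rewrite posrE addr_gt0].
have : ln (1 + N%:R^-1) <= N%:R^-1 :> R.
  by apply: le_ln1Dx; apply: lt_trans i0; rewrite ltrN10.
have := IH nN; lra.
Qed.

Context (C sigma2 K eps : R).
Hypotheses (C_ge4 : 4 <= C) (sigma2_gt0 : 0 < sigma2) (K_ge1 : 1 <= K)
  (eps_gt0 : 0 < eps) (eps_lt1 : eps < 1).

(* Bounds the sum of [exp (V x0 - V)] over the explored sites [-x0, x0]. *)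
Definition wide (x0 : nat) : R := (x0.*2.+1)%:R * expR (2 * C * x0%:R).

(** The first three conditions are those of [Ex_block_good]. The last makes the constants and the
    number of sites negligible against [expR (h / 2)]. *)
Definition scale_ok (x0 n : nat) (h : R) : Prop :=
  [/\ C <= h, wide x0 * (1 + C) <= h, 66 * (121 * h ^+ 2) <= sigma2 * n%:R, (0 < n)%N &
   128 * K ^+ 2 * (1 + expR C) * ((x0 + n).*2.+1)%:R <= eps * expR (h / 2)].

(** [n] is of order [h ^ 2] whereas [expR (h / 2)] is at least [h ^ 3 / 48], so a large [h] wins by
    one power. *)
Lemma scale_exists x0 : exists n h, scale_ok x0 n h.
Proof.
have C4 := C_ge4; have K1 := K_ge1; have s0 := sigma2_gt0; have e0 := eps_gt0.
pose A : R := 128 * K ^+ 2 * (1 + expR C).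
have A0 : 0 < A.
  by rewrite !mulr_gt0 ?exprn_gt0 ?addr_gt0 ?expR_gt0//; lra.
(* Chosen so that [2 * (x0 + n) + 1 <= L * h ^ 2]. *)
pose L : R := 2 * x0%:R + 3 + 132 * 121 / sigma2.
have L0 : 0 <= L by rewrite !addr_ge0 ?mulr_ge0 ?ler0n ?invr_ge0 ?ltW//; lra.
pose h : R := C + wide x0 * (1 + C) + 48 * (A * L / eps).
have w0 : 0 <= wide x0 by rewrite /wide mulr_ge0 ?expR_ge0 ?ler0n.
have AL0 : 0 <= A * L / eps by apply: divr_ge0; [apply: mulr_ge0 => //; exact: ltW|exact: ltW].
have wC : 0 <= wide x0 * (1 + C) by rewrite mulr_ge0//; lra.
have hC : C <= h by rewrite /h; lra.
have h2 : 0 <= h ^+ 2 by exact: sqr_ge0.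
pose n := (Num.truncn (66 * (121 * h ^+ 2) / sigma2)).+1.
have x0' : 0 <= 66 * (121 * h ^+ 2) / sigma2.
  apply: divr_ge0; last exact: ltW.
  by rewrite mulr_ge0 ?ler0n// mulr_ge0 ?ler0n.
have /andP[t1 t2] := truncn_itv x0'.
exists n, h; split => //.
- by rewrite /h; lra.
- by move: t2; rewrite ltr_pdivrMr// => /ltW; rewrite [leRHS]mulrC.
rewrite -/A.
have nle : n%:R <= 66 * (121 * h ^+ 2) / sigma2 + 1 by rewrite /n -natr1 lerD2r.
have h1 : ((x0 + n).*2.+1)%:R <= L * h ^+ 2.
  rewrite -natr1 -muln2 natrM natrD.
  have hh : 1 <= h ^+ 2 by rewrite expr2; nra.
  have xx : 0 <= x0%:R :> R by rewrite ler0n.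
  have -> : L * h ^+ 2 = 2 * (x0%:R * h ^+ 2) + 3 * h ^+ 2 + 2 * (66 * (121 * h ^+ 2) / sigma2).
    by rewrite /L; field; rewrite gt_eqF.
  have : x0%:R <= x0%:R * h ^+ 2 by rewrite ler_peMr.
  lra.
have h3 : h ^+ 3 / 48 <= expR (h / 2).
  have hp : 0 <= h / 2 by lra.
  have := expR_ge1Dxn 2 hp; rewrite (_ : 3`! = 6)%N//.
  have -> : (h / 2) ^+ 3 / 6 = h ^+ 3 / 48 by field.
  lra.
apply: (@le_trans _ _ (eps * (h ^+ 3 / 48))); last by rewrite ler_pM2l.
apply: (@le_trans _ _ (A * (L * h ^+ 2))); first by rewrite ler_pM2l.
have h4 : 48 * (A * L / eps) <= h by rewrite /h; lra.
have h5 : A * L <= eps * (h / 48).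
  have : A * L / eps <= h / 48 by lra.
  by rewrite ler_pdivrMr// [leRHS]mulrC.
have -> : eps * (h ^+ 3 / 48) = eps * (h / 48) * h ^+ 2 by ring.
by rewrite mulrA ler_wpM2r.
Qed.

Context (e : int -> R) (G : R).
Hypotheses (e_ge : forall x, eps <= e x) (e_le : forall x, e x <= 1 - eps)
  (xi_le : forall x, `|ln ((1 - e x) / e x)| <= C)
  (KE : K = 2 * G * (1 + expR C)).
Let xi (z : int) := ln ((1 - e z) / e z).
Local Notation V := (potential xi).
Local Notation W := (fun z => expR (V z)).

Lemma potential_rec x : W x * e x = (1 - e x) * W (x - 1).
Proof.
have e0 := eps_gt0; have e1 := e_ge x; have e2 := e_le x.
have -> : V x = V (x - 1) + xi x by rewrite -{1}(subrK 1 x) potentialS subrK.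
rewrite expRD /xi lnK ?posrE; last by rewrite divr_gt0//; lra.
by field; rewrite gt_eqF//; lra.
Qed.

(** The window extends from [expR (6 h - V b)] to [expR (9 h - V b)]. After rounding its logarithmic
    length is at least [2 h], while [ln N] is at most [21 h / 2]; hence the factor 6. *)
Lemma meeting_window x0 n h : scale_ok x0 n h ->
  let s0 := wide x0 in
  10 * h <= vpos (vrun h s0 (fun k => xi (x0%:Z + k.+1%:Z)) n) ->
  vsum (vrun h s0 (fun k => xi (x0%:Z + k.+1%:Z)) n) <= G ->
  10 * h <= vpos (vrun h s0 (fun k => - xi (- x0%:Z - k%:Z)) n) ->
  vsum (vrun h s0 (fun k => - xi (- x0%:Z - k%:Z)) n) <= G ->
  exists (b : int) (n1 N : nat),
    [/\ (0 < n1)%N, (n1 <= N.+1)%N, (1 < N)%N & (x0 <= N)%N] /\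
    ln (N%:R : R) <= 6 * (ln N.+1%:R - ln n1%:R) /\
    forall (t : nat) (y : int), (n1 <= t <= N)%N -> - x0%:Z <= y -> y + 1 <= x0%:Z ->
      eps ^+ 2 <= 8 * K * pstep e t y (meeting_site b t y).
Proof.
move=> [hC s0h _ n0 hK] s0 highR sumR highL sumL.
have C4 := C_ge4; have K1 := K_ge1; have e0 := eps_gt0; have e1 := eps_lt1.
have h0 : 0 < h by lra.
have C0 : 0 < C by lra.
have [a [b [m [[ab bm mn] [[Va Vc Vb1 Vb2] [sumI bar]]]]]] :=
  valley_exists C0 xi_le h0 erefl highR sumR highL sumL.
have KE' := KE; set E := expR C in KE' hK *.
have E0 : 0 < E by exact: expR_gt0.
pose x0R : R := x0%:R; rewrite -/x0R in Va Vc Vb1 Vb2 bar.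
have x00 : 0 <= x0R by rewrite ler0n.
have wge : 1 + 2 * C * x0R <= wide x0.
  apply: (le_trans (expR_ge1Dx _)).
  by rewrite /wide -/x0R ler_peMl ?expR_ge0// ler1n.
have wge2 : x0R <= wide x0.
  have : (x0.*2.+1)%:R * 1 <= wide x0.
    rewrite /wide ler_pM2l ?ltr0n// -(@expR0 R) ler_expR.
    by rewrite !mulr_ge0// ltW.
  rewrite mulr1; apply: le_trans; rewrite ler_nat -addnn; apply: leqW.
  exact: leq_addr.
have w1 : wide x0 <= h.
  by apply: le_trans s0h; rewrite ler_peMr//; [apply: le_trans wge2|lra].
(* The potential on the explored sites, bounded by [C * x0], is small compared with the scale. *)
have Cx0 : C * x0R <= h / 2 by lra.
have W0 z : 0 < W z by exact: expR_gt0.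
have Wrec := potential_rec.
have WS z : (W (z - 1))^-1 <= E / W z.
  rewrite -!expRN -expRD ler_expR.
  have := potentialS xi (z - 1); rewrite subrK => ->.
  by have := xi_le z; rewrite ler_norml -/(xi z) => /andP[]; lra.
have rle z : revm W z <= (1 + E) / W z.
  by rewrite /revm mulrDl mul1r addrC lerD2l.
have rge z : (W z)^-1 <= revm W z.
  by rewrite /revm lerDr invr_ge0 ltW.
(* Weight of an end of the valley relative to the bottom; the ends have height [10 h] up to
   [C * x0]. *)
pose delta := (1 + E) * expR (V b + C * x0R - 10 * h).
have end_le z : 10 * h - C * x0R <= V z -> revm W z <= delta * revm W b.
  move=> Vz; apply: (le_trans (rle z)).
  apply: (@le_trans _ _ (delta / W b)).
    rewrite /delta -!expRN -mulrA -expRD ler_pM2l ?addr_gt0// ler_expR; lra.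
  by rewrite ler_pM2l ?rge// mulr_gt0 ?expR_gt0 ?addr_gt0.
have sumK : isum a m.+1 (revm W) <= K * revm W b.
  apply: (@le_trans _ _ ((1 + E) * isum a m.+1 (fun z => (W z)^-1))).
    by rewrite -isumZ; apply: isum_le => z _ _; exact: rle.
  apply: (@le_trans _ _ (K / W b)).
    rewrite KE' mulrC [2 * G * _ / _]mulrAC ler_pM2r ?addr_gt0//.
  by rewrite ler_pM2l ?rge//; lra.
pose r := ((x0 + n).*2.+1)%:R * expR (5 * h + C * x0R).
pose a1 := expR (6 * h - V b); pose a2 := expR (9 * h - V b).
have a10 : 0 <= a1 by exact: expR_ge0.
have a20 : 0 <= a2 by exact: expR_ge0.
have /andP[u1 u2] := truncn_itv a10; have /andP[v1 v2] := truncn_itv a20.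
have a1ge : 2 <= a1 by apply: le_trans (expR_ge1Dx _); lra.
have a2ge : 8 * h + 1 <= a2 by apply: le_trans (expR_ge1Dx _); lra.
(* With this rounding, [t.-1 >= a1 / 2] for all times [t] of the window, since [a1 >= 2]. *)
exists b, (Num.truncn a1).+1, (Num.truncn a2).
have leN : (Num.truncn a1 <= Num.truncn a2)%N.
  by rewrite truncn_ge_nat//; apply: (le_trans u1); rewrite ler_expR; lra.
have N2 : (1 < Num.truncn a2)%N by rewrite truncn_gt_nat; lra.
split.
  split => //; rewrite truncn_ge_nat// -/x0R; lra.
split.
  have n1le : ln (Num.truncn a1).+1%:R <= 7 * h - V b.
    rewrite -[leRHS]expRK ler_ln ?posrE ?expR_gt0 ?ltr0n//.
    rewrite -natr1; apply: (@le_trans _ _ (2 * a1)); first by lra.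
    have -> : 7 * h - V b = h + (6 * h - V b) by ring.
    rewrite expRD ler_pM2r ?expR_gt0//; apply: le_trans (expR_ge1Dx _); lra.
  have Nge : 9 * h - V b <= ln (Num.truncn a2).+1%:R.
    rewrite -[leLHS]expRK ler_ln ?posrE ?expR_gt0 ?ltr0n//; exact: ltW.
  have Nle : ln (Num.truncn a2)%:R <= 9 * h - V b.
    rewrite -[leRHS]expRK ler_ln ?posrE ?expR_gt0 ?ltr0n//.
    exact: ltn_trans N2.
  lra.
move=> t y /andP[t1 t2] y1 y2.
have t0 : (0 < t)%N by apply: leq_trans t1.
have E1 : 0 <= 1 + E by rewrite addr_ge0// ltW.
have c128 : 0 <= 128 * K ^+ 2 by rewrite mulr_ge0 ?ler0n ?sqr_ge0.
have c64 : 0 <= 64 * K ^+ 2 by rewrite mulr_ge0 ?ler0n ?sqr_ge0.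
have big : 128 * K ^+ 2 * (1 + E) <= expR (h / 2).
  apply: (@le_trans _ _ (eps * expR (h / 2))); last first.
    by rewrite ler_piMl ?expR_ge0// ltW.
  apply: le_trans hK; rewrite ler_peMr//; last by rewrite ler1n.
  by rewrite mulr_ge0.
have d0 : 0 <= delta by rewrite mulr_ge0 ?expR_ge0.
have KK : 1 <= K ^+ 2 by rewrite expr2; nra.
apply: (@pstep_lower R e W eps e0 e_ge e_le W0 Wrec a b m x0 delta K r) => //.
- exact: end_le.
- exact: end_le.
(* Until time [a2] the ends are not reached: [2 * t * delta] is at most [expR (h / 2 + C * x0 - h)],
   hence at most 1. *)
- have tle : t%:R <= a2 by apply: le_trans v1; rewrite ler_nat.
  apply: (@le_trans _ _ (2 * a2 * delta)).
    by rewrite ler_wpM2r// ler_pM2l.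
  have -> : 2 * a2 * delta = 2 * (1 + E) * expR (C * x0R - h).
    rewrite /delta /a2; have -> : 2 * expR (9 * h - V b) *
      ((1 + E) * expR (V b + C * x0R - 10 * h)) = 2 * (1 + E) *
      (expR (9 * h - V b) * expR (V b + C * x0R - 10 * h)) by ring.
    by rewrite -expRD; congr (_ * expR _); ring.
  apply: (@le_trans _ _ (expR (h / 2) * expR (C * x0R - h))).
    rewrite ler_wpM2r ?expR_ge0//; apply: le_trans big; nra.
  by rewrite -expRD -[leRHS](@expR0 R) ler_expR; lra.
(* After time [a1] the starting point is forgotten: the barrier [5 h + C * x0] plus the [h / 2]
   granted by [scale_ok] does not exceed [6 h]. *)
apply: (@le_trans _ _ (64 * K ^+ 2 * ((1 + E) / W b * r))).
  apply: ler_wpM2l => //; apply: ler_wpM2r; last exact: rle.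
  by rewrite /r mulr_ge0 ?expR_ge0 ?ler0n.
have -> : 64 * K ^+ 2 * ((1 + E) / W b * r) =
    128 * K ^+ 2 * (1 + E) * ((x0 + n).*2.+1)%:R *
      (expR (5 * h + C * x0R) / W b / 2) by rewrite /r; field; rewrite gt_eqF.
apply: (@le_trans _ _ (eps * expR (h / 2) * (expR (5 * h + C * x0R) / W b / 2))).
  by rewrite ler_wpM2r// divr_ge0// divr_ge0 ?expR_ge0.
rewrite -mulrA ler_pM2l// -expRN !mulrA -!expRD.
apply: (@le_trans _ _ (a1 / 2)).
  by rewrite ler_pM2r// ler_expR; lra.
have : (Num.truncn a1)%:R <= t.-1%:R :> R by rewrite ler_nat; clear - t1; lia.
by rewrite -natr1 in u2; lra.
Qed.

End scales.

(** * Infinitely many good scales *)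

Section walks.
Context d (T : measurableType d) (R : realType) (Q : probability T R)
  (e : int -> R) (y : int) (Z : nat -> {RV Q >-> int}).
Hypotheses (e_ge0 : forall x, 0 <= e x) (e_le1 : forall x, e x <= 1)
  (walk : walk_in_environment e y Z).

Definition path_event (k : nat) (z : nat -> int) : set T :=
  [set t | forall i, (i <= k)%N -> Z i t = z i].

Lemma measurable_at n x : measurable [set t | Z n t = x].
Proof.
rewrite (_ : [set t | _] = Z n @^-1` [set x]); last by [].
exact: measurable_funPTI.
Qed.

Lemma measurable_path_event k z : measurable (path_event k z).
Proof.
rewrite (_ : path_event k z = \bigcap_(i in [set i | (i <= k)%N]) [set t | Z i t = z i]).
  by apply: bigcap_measurable; [exists 0%N|move=> i _; exact: measurable_at].
by apply/seteqP; split => t h i /=; exact: h.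
Qed.

Lemma pstep_nonneg n x x' : 0 <= pstep e n x x'.
Proof.
elim: n x => [|n IH] x /=; first exact: ler0n.
by rewrite addr_ge0 ?mulr_ge0 ?subr_ge0.
Qed.

(** A lower bound suffices, so the induction keeps the two disjoint continuations of the path to the
    neighbours of [z k]. The whole past is prescribed to match the product form of the Markov
    property. *)
Lemma path_event_pstep n k z x :
  (Q (path_event k z) * (pstep e n (z k) x)%:E <=
    Q (path_event k z `&` [set t | Z (k + n)%N t = x]))%E.
Proof.
elim: n k z => [|n IH] k z.
  rewrite addn0 /=; case: eqP => [zx|_]; last by rewrite mule0.
  rewrite mule1 le_eqVlt; apply/orP; left; apply/eqP; congr (Q _).
  apply/seteqP; split => [t h|t []//].
  by split => //=; rewrite (h k).
pose ext (s : int) (i : nat) : int := if (i <= k)%N then z i else s.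
have extk s : ext s k = z k by rewrite /ext leqnn.
have extk1 s : ext s k.+1 = s by rewrite /ext ltnn.
have pre s : path_event k (ext s) = path_event k z.
  by apply/seteqP; split => t h i ik; have := h i ik; rewrite /ext ik.
have markov s : Q (path_event k.+1 (ext s)) =
    (Q (path_event k z) * (transition e (z k) s)%:E)%E.
  by have := walk.2 k (ext s); rewrite -/(path_event k (ext s)) pre extk extk1.
pose A s := path_event k.+1 (ext s) `&` [set t | Z (k.+1 + n)%N t = x].
have mA s : measurable (A s).
  by apply: measurableI; [exact: measurable_path_event|exact: measurable_at].
have low s : (Q (path_event k z) * (transition e (z k) s * pstep e n s x)%:E <= Q (A s))%E.
  by have := IH k.+1 (ext s); rewrite markov extk1 EFinM muleA.
have disj : A (z k + 1) `&` A (z k - 1) = set0.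
  apply/seteqP; split => // t [[h1 _] [h2 _]]; have := h1 k.+1 (leqnn _).
  have := h2 k.+1 (leqnn _); rewrite !extk1 => -> ; lia.
have sub s : A s `<=` path_event k z `&` [set t | Z (k + n.+1)%N t = x].
  move=> t [h1 h2]; split; last by rewrite -addSnnS.
  by move=> i ik; rewrite (h1 i (leqW ik)) /ext ik.
apply: (@le_trans _ _ (Q (A (z k + 1) `|` A (z k - 1)))); last first.
  apply: le_measure; rewrite ?inE.
  - exact: measurableU.
  - by apply: measurableI; [exact: measurable_path_event|exact: measurable_at].
  - by rewrite subUset; split; exact: sub.
rewrite measureU//.
have t1 : transition e (z k) (z k + 1) = e (z k) by rewrite /transition eqxx.
have t2 : transition e (z k) (z k - 1) = 1 - e (z k).
  rewrite /transition eqxx; case: eqP => //; lia.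
have := low (z k + 1); have := low (z k - 1); rewrite t1 t2 => l1 l2.
apply: le_trans (leeD l2 l1).
rewrite -ge0_muleDr ?lee_fin ?mulr_ge0 ?pstep_nonneg ?subr_ge0//.
Qed.

Lemma walk_pstep_le n x : ((pstep e n y x)%:E <= Q [set t | Z n t = x])%E.
Proof.
have := path_event_pstep n 0 (fun=> y) x.
have -> : path_event 0 (fun=> y) = [set t | Z 0%N t = y].
  apply/seteqP; split => [t h|t h i]; first exact: h.
  by rewrite leqn0 => /eqP ->.
rewrite walk.1 mul1e => h; apply: (le_trans h).
apply: le_measure; rewrite ?inE; last by move=> t [].
- by apply: measurableI; exact: measurable_at.
- exact: measurable_at.
Qed.

End walks.

Lemma limn_esup_ge (R : realType) (u : (\bar R)^nat) (c : \bar R) :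
  (forall M : nat, exists2 N : nat, (M <= N)%N & (c <= u N)%E) -> (c <= limn_esup u)%E.
Proof.
move=> h; rewrite limn_esup_lim; apply: lime_ge; first exact: is_cvg_esups.
apply: nearW => M; have [N MN cu] := h M.
apply: (le_trans cu); apply: ereal_sup_ubound; exists N => //=.
Qed.

Lemma lee_prod_const (R : realType) (r : nat) (c : R) (f : 'I_r -> \bar R) :
  0 <= c -> (forall j, (c%:E <= f j)%E) -> ((c ^+ r)%:E <= \prod_(j < r) f j)%E.
Proof.
move=> c0 cf.
have -> : ((c ^+ r)%:E = \prod_(j < r) c%:E)%E.
  elim: r {f cf} => [|r IH]; first by rewrite big_ord0.
  by rewrite big_ord_recr /= -IH exprSr EFinM.
suff [] : (0 <= \prod_(j < r) c%:E)%E /\ (\prod_(j < r) c%:E <= \prod_(j < r) f j)%E.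
  by [].
apply: (big_ind2 (fun a b => (0 <= a)%E /\ (a <= b)%E)) => //.
  move=> a1 b1 a2 b2 [h1 h2] [h3 h4]; split; first exact: mule_ge0.
  exact: lee_pmul.
Qed.

(** * Meetings during one time window *)

Section meetings.
Context (R : realType) (e : int -> R) (eps K : R) (b : int) (n1 N : nat) (X : nat)
  (r : nat).
Hypotheses (e_ge0 : forall x, 0 <= e x) (e_le1 : forall x, e x <= 1)
  (eps_gt0 : 0 < eps) (K_ge1 : 1 <= K) (r_gt0 : (0 < r)%N)
  (n1_gt0 : (0 < n1)%N) (n1N : (n1 <= N.+1)%N) (N_gt1 : (1 < N)%N)
  (ln_le : ln N%:R <= 6 * (ln N.+1%:R - ln n1%:R) :> R)
  (low : forall (t : nat) (y : int), (n1 <= t <= N)%N -> - X%:Z <= y -> y + 1 <= X%:Z ->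
      eps ^+ 2 <= 8 * K * pstep e t y (meeting_site b t y)).

(** Starting points of equal parity share the same meeting site. Only this site and the times of the
    window are kept, and the harmonic sum over the window is at least [ln N / 6]. *)
Lemma meetings_lower (y : 'I_r -> int) :
  (forall j, (2 %| y j)%Z) \/ (forall j, ~~ (2 %| y j)%Z) ->
  (forall j, - X%:Z <= y j /\ y j + 1 <= X%:Z) ->
  forall (d' : measure_display) (T : measurableType d')
    (Q : probability T R) (Z : 'I_r -> nat -> {RV Q >-> int}),
    (forall j, walk_in_environment e (y j) (Z j)) ->
  (((eps ^+ 2 / (8 * K)) ^+ r / 6)%:E <=
    ((ln N%:R)^-1)%:E * \sum_(1 <= n < N.+1) (n%:R^-1)%:E *
        (\esum_(k in [set: int]) \prod_(j < r) Q [set t | Z j n t = k]))%E.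
Proof.
move=> par yX d' T Q Z walk.
set c := eps ^+ 2 / (8 * K).
have K1 := K_ge1; have K8 : 0 < 8 * K by lra.
have c0 : 0 <= c by rewrite divr_ge0 ?sqr_ge0// ltW.
have lnN : 0 < ln N%:R :> R by rewrite ln_gt0// ltr1n.
pose j0 : 'I_r := Ordinal r_gt0.
have site_eq n j : meeting_site b n (y j) = meeting_site b n (y j0).
  rewrite /meeting_site; congr (if _ then _ else _).
  by case: par => par; have := par j; have := par j0; lia.
have nonneg n : (0 <= \esum_(k in [set: int]) \prod_(j < r) Q [set t | Z j n t = k])%E.
  by apply: esum_ge0 => k _; apply: prode_ge0 => j _.
have term n : (n1 <= n <= N)%N ->
    ((c ^+ r)%:E <= \esum_(k in [set: int]) \prod_(j < r) Q [set t | Z j n t = k])%E.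
  move=> nn; set k := meeting_site b n (y j0).
  apply: (@le_trans _ _ (\prod_(j < r) Q [set t | Z j n t = k])%E).
    apply: lee_prod_const => // j.
    apply: le_trans (walk_pstep_le e_ge0 e_le1 (walk j) n k).
    have [y1 y2] := yX j; have := low nn y1 y2; rewrite site_eq -/k => h.
    by rewrite lee_fin /c ler_pdivrMr// mulrC.
  apply: esum_ge; exists [set k]; last by rewrite fsbig_set1.
  by split => //; exact: finite_set1.
have harm : (((c ^+ r) * (ln N.+1%:R - ln n1%:R))%:E <=
    \sum_(1 <= n < N.+1) (n%:R^-1)%:E *
        (\esum_(k in [set: int]) \prod_(j < r) Q [set t | Z j n t = k]))%E.
  rewrite (big_cat_nat _ n1N)//=.
  have h1 : (0 <= \sum_(1 <= n < n1) (n%:R^-1)%:E *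
        (\esum_(k in [set: int]) \prod_(j < r) Q [set t | Z j n t = k]))%E.
    by apply: sume_ge0 => n _; rewrite mule_ge0// lee_fin invr_ge0.
  apply: le_trans (leeDr _ h1).
  apply: (@le_trans _ _ (\sum_(n1 <= n < N.+1) (c ^+ r * n%:R^-1)%:E)%E).
    rewrite sumEFin lee_fin -mulr_sumr ler_wpM2l ?exprn_ge0//.
    exact: ln_le_harmonic.
  rewrite [X in (X <= _)%E]big_nat [X in (_ <= X)%E]big_nat; apply: lee_sum => n nn.
  rewrite mulrC EFinM; apply: lee_pmul.
  - by rewrite lee_fin invr_ge0.
  - by rewrite lee_fin exprn_ge0.
  - by [].
  - by apply: term; move: nn; rewrite ltnS.
apply: (@le_trans _ _ (((ln N%:R)^-1)%:E *
    ((c ^+ r) * (ln N.+1%:R - ln n1%:R))%:E)%E).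
  rewrite -EFinM lee_fin [leRHS]mulrC ler_pdivlMr// -mulrA.
  by apply: ler_wpM2l; [rewrite exprn_ge0|have := ln_le; lra].
by apply: lee_wpmul2l => //; rewrite lee_fin invr_ge0 ltW.
Qed.

End meetings.

Section log_ratio.
Context (R : realType) (eps : R).
Hypothesis eps_bounds : 0 < eps < 1 / 2.

(* Clipping makes [log_rho] bounded everywhere; almost surely it changes
   nothing. *)
Definition clip (t : R) : R := Num.max eps (Num.min t (1 - eps)).
Definition log_rho (t : R) : R := ln (1 - clip t) - ln (clip t).
(** The summand 4 ensures the lower bound on [C] used in [expR_half_ge]. *)
Definition log_rho_bound : R := 4 - ln eps.

Lemma clip_bounds t : eps <= clip t <= 1 - eps.
Proof.
have /andP[e0 e1] := eps_bounds.
rewrite /clip le_max lexx ge_max ge_min lexx orbT andbT /=; lra.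
Qed.

Lemma clip_id t : eps <= t <= 1 - eps -> clip t = t.
Proof. by move=> /andP[h1 h2]; rewrite /clip min_l// max_r. Qed.

Lemma log_rhoE t : eps <= t <= 1 - eps -> log_rho t = ln ((1 - t) / t).
Proof.
move=> ht; have /andP[h1 h2] := ht; have /andP[e0 e1] := eps_bounds.
by rewrite /log_rho clip_id// ln_div// posrE; lra.
Qed.

Lemma log_rho_bound_ge4 : 4 <= log_rho_bound.
Proof.
have /andP[e0 e1] := eps_bounds.
have : ln eps <= 0 by apply: ln_le0; lra.
by rewrite /log_rho_bound; lra.
Qed.

Lemma log_rho_le t : `|log_rho t| <= log_rho_bound.
Proof.
have /andP[e0 e1] := eps_bounds; have /andP[c1 c2] := clip_bounds t.
have l1 : ln eps <= ln (clip t) by rewrite ler_ln ?posrE//; lra.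
have l2 : ln (clip t) <= 0 by apply: ln_le0; lra.
have l3 : ln eps <= ln (1 - clip t) by rewrite ler_ln ?posrE//; lra.
have l4 : ln (1 - clip t) <= 0 by apply: ln_le0; lra.
by rewrite ler_norml /log_rho /log_rho_bound; apply/andP; split; lra.
Qed.

Lemma measurable_log_rho : measurable_fun setT log_rho.
Proof.
have mc : measurable_fun setT clip.
  apply: measurable_maxr; first exact: measurable_cst.
  by apply: measurable_minr; [exact: measurable_id|exact: measurable_cst].
apply: measurable_funB.
  apply: (@measurableT_comp _ _ _ _ _ _ (@ln R)) => //.
  by apply: measurable_funB => //; exact: measurable_cst.
exact: (@measurableT_comp _ _ _ _ _ _ (@ln R)).
Qed.

End log_ratio.

(** * The random environment and its successive stages *)

Section environment.
Context (R : realType) (d : measure_display)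
    (Omega : measurableType d) (P : probability Omega R)
    (omega : int -> {RV P >-> R})
    (omega_iid : iid_environment omega)
    (eps0 : R) (eps0_bounds : 0 < eps0 < 1 / 2)
    (elliptic : P [set w | eps0 <= omega 0 w <= 1 - eps0] = 1%E)
    (recurrent : ('E_P[fun w => (ln (rho (omega 0 w)))%R] = 0)%E)
    (nondegenerate : (0 < 'E_P[fun w => (ln (rho (omega 0 w)) ^+ 2)%R])%E).

Local Notation psi := (log_rho eps0).
Local Notation C := (log_rho_bound eps0).

Definition elliptic_at (x : int) : set Omega :=
  [set w | eps0 <= omega x w <= 1 - eps0].

Lemma elliptic_set x : elliptic_at x = omega x @^-1` `[eps0, 1 - eps0]%classic.
Proof. by apply/seteqP; split => w /=; rewrite in_itv. Qed.

Lemma measurable_elliptic x : measurable (elliptic_at x).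
Proof. by rewrite elliptic_set; exact: measurable_funPTI. Qed.

Lemma elliptic_prob x : P (elliptic_at x) = 1%E.
Proof.
have [_ _ same] := omega_iid.
rewrite -elliptic elliptic_set -/(elliptic_at 0) elliptic_set.
exact: (same x _ (measurable_itv _)).
Qed.

Lemma elliptic_ae x : {ae P, forall w, eps0 <= omega x w <= 1 - eps0}.
Proof.
exists (~` elliptic_at x); split => //.
  by apply: measurableC; exact: measurable_elliptic.
by rewrite probability_setC ?elliptic_prob ?subee//; exact: measurable_elliptic.
Qed.

Lemma log_rho_omega_bpast (D : set int) j : D j ->
  bpast omega D (fun w => psi (omega j w)).
Proof.
move=> Dj; apply: bpast_omega Dj (measurable_log_rho eps0) _.
exact: log_rho_le eps0_bounds.
Qed.

(** By ellipticity clipping acts on a null set only, so recurrence and nondegeneracy carry over to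
    [psi]. *)
Lemma log_rho_expectation (f : R -> R) : measurable_fun setT f ->
  (exists M, forall x, `|f (psi x)| <= M) ->
  ('E_P[fun w => f (ln (rho (omega 0 w)))] = (Ex P (fun w => f (psi (omega 0 w))))%:E)%E.
Proof.
move=> mf [M fM].
have mlr : measurable_fun setT (fun w => ln (rho (omega 0 w))).
  have -> : (fun w => ln (rho (omega 0 w))) =
      (fun w => ln (1 - omega 0 w) - ln (omega 0 w)).
    apply/funext => w; have [/(_ 0 w)/andP[h1 h2] _ _] := omega_iid.
    by rewrite /rho ln_div// posrE subr_gt0.
  apply: measurable_funB; apply: (@measurableT_comp _ _ _ _ _ _ (@ln R)) => //.
  by apply: measurable_funB => //; exact: measurable_cst.
have bp : bpast omega [set: int] (fun w => f (psi (omega 0 w))).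
  apply: (@bpast_omega _ _ _ _ omega setT 0 (f \o psi) M) => //.
  by apply: measurableT_comp => //; exact: measurable_log_rho.
rewrite unlock /Ex /Rintegral fineK; last first.
  exact: integrable_fin_num (bpast_integrable bp).
apply: ae_eq_integral => //.
- by apply/measurable_EFinP; apply: measurableT_comp.
- by apply/measurable_EFinP; exact: bpast_measurable bp.
have := elliptic_ae 0; apply: filterS => w /= hw _.
by rewrite (log_rhoE eps0_bounds hw).
Qed.

Definition variance : R := Ex P (fun w => psi (omega 0 w) ^+ 2).
Local Notation sigma2 := variance.

Lemma log_rho_sqr_le x : `|psi x ^+ 2| <= C ^+ 2.
Proof.
have b := log_rho_le eps0_bounds x.
by rewrite normrX ler_pXn2r// nnegrE//; apply: le_trans b.
Qed.

Lemma variance_gt0 : 0 < sigma2.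
Proof.
have := @log_rho_expectation (fun x => x ^+ 2) (exprn_measurable _).
move=> /(_ (ex_intro _ (C ^+ 2) log_rho_sqr_le)) E.
by move: nondegenerate; rewrite E lte_fin.
Qed.

Lemma Ex_same_law (f : R -> R) (M : R) j : measurable_fun setT f ->
  (forall x, `|f x| <= M) ->
  Ex P (fun w => f (omega j w)) = Ex P (fun w => f (omega 0 w)).
Proof.
move=> mf fM; rewrite /Ex /Rintegral; congr fine.
have bp k : bpast omega [set: int] (fun w => f (omega k w)).
  exact: bpast_omega mf fM.
have tr k : (\int[P]_w (f (omega k w))%:E =
    \int[distribution P (omega k)]_x (f x)%:E)%E.
  rewrite integral_distribution//; first exact/measurable_EFinP.
  exact: bpast_integrable (bp k).
rewrite !tr; apply: eq_measure_integral => A mA _.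
by have [_ _ same] := omega_iid; exact: same.
Qed.

Lemma log_rho_mean j : Ex P (fun w => psi (omega j w)) = 0.
Proof.
rewrite (Ex_same_law j (measurable_log_rho eps0) (log_rho_le eps0_bounds)).
have mid : measurable_fun [set: R] id by exact: measurable_id.
have := log_rho_expectation mid (ex_intro _ C (log_rho_le eps0_bounds)).
by rewrite /= recurrent => -[].
Qed.

Lemma log_rho_var j : Ex P (fun w => psi (omega j w) ^+ 2) = sigma2.
Proof.
rewrite /variance (@Ex_same_law (fun x => psi x ^+ 2) (C ^+ 2) j)//.
  by apply: measurable_funX; exact: measurable_log_rho.
exact: log_rho_sqr_le.
Qed.

Local Notation G := (good_sum C sigma2).
(** Mass of a valley relative to its bottom: [2 * G] for the two blocks, and [1 + expR C] for
    passing from [(W z)^-1] to [revm W z]. *)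
Definition mass_ratio : R := 2 * G * (1 + expR C).
Local Notation K := mass_ratio.

Lemma mass_ratio_ge1 : 1 <= K.
Proof.
have C4 := log_rho_bound_ge4 eps0_bounds; have s0 := variance_gt0.
have B0 := lyapB_gt0 C4 s0; have D0 := lyapD_gt0 C4 s0.
have G7 : 7 <= G by rewrite /good_sum; lra.
have e0 := expR_gt0 C; rewrite /mass_ratio; nra.
Qed.

Section stages.
Context (nn : nat -> nat) (hh : nat -> R).
Hypothesis scales : forall x0, scale_ok C sigma2 K eps0 x0 (nn x0) (hh x0).

Fixpoint stage (m : nat) : nat :=
  if m is k.+1 then (stage k + nn (stage k))%N else 0%N.

Lemma stage_ge m : (m <= stage m)%N.
Proof.
elim: m => [|m IH] //=; have [_ _ _ n0 _] := scales (stage m).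
by rewrite -addn1; exact: leq_add.
Qed.

Definition right_site (m i : nat) : int := (stage m)%:Z + i.+1%:Z.
Definition left_site (m i : nat) : int := - (stage m)%:Z - i%:Z.
(** Half-open because the increments at these sites are exactly those which determine the potential
    on [[- stage m, stage m]]. *)
Definition explored (m : nat) : set int :=
  [set z | - (stage m)%:Z < z /\ z <= (stage m)%:Z].

Lemma right_site_inj m : injective (right_site m).
Proof. by move=> i j; rewrite /right_site; clear; lia. Qed.

Lemma left_site_inj m : injective (left_site m).
Proof. by move=> i j; rewrite /left_site; clear; lia. Qed.

Lemma explored_sub m : explored m `<=` explored m.+1.
Proof. by move=> z; rewrite /explored /= => -[z1 z2]; split; clear - z1 z2; lia. Qed.

Definition right_good (m : nat) : Omega -> R :=
  block_good omega C sigma2 psi (right_site m) (hh (stage m)) (wide C (stage m))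
    (nn (stage m)).

Definition left_good (m : nat) : Omega -> R :=
  block_good omega C sigma2 (fun x => - psi x) (left_site m) (hh (stage m))
    (wide C (stage m)) (nn (stage m)).

(** A real-valued indicator, so that it can serve as the weight [F] for the next stage. *)
Fixpoint no_success (M k : nat) (w : Omega) : R :=
  if k is j.+1 then
    no_success M j w * (1 - right_good (M + j) w * left_good (M + j) w)
  else 1.

Lemma good01 m w : (right_good m w = 0 \/ right_good m w = 1) /\
  (left_good m w = 0 \/ left_good m w = 1).
Proof.
by rewrite /right_good /left_good /block_good; split; case: ifP => _; [right|left|right|left].
Qed.

Lemma no_success_ge0 M k w : 0 <= no_success M k w.
Proof.
elim: k => [|k IH] //=; apply: mulr_ge0 => //.
by case: (good01 (M + k) w) => -[->|->] [->|->]; lra.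
Qed.

Let right_explored m := sites_upto (explored m) (right_site m) (nn (stage m)).

Lemma explored_step m :
  sites_upto (right_explored m) (left_site m) (nn (stage m)) `<=` explored m.+1.
Proof.
move=> z; rewrite /explored /=; case=> [[[z1 z2]|[i /= im <-]]|[i /= im <-]].
- by clear - z1 z2; split; lia.
- by rewrite /right_site; clear - im; split; lia.
- by rewrite /left_site; clear - im; split; lia.
Qed.

Lemma right_new m i : ~ explored m (right_site m i).
Proof. by rewrite /explored /right_site /= => -[_]; clear; lia. Qed.

Lemma left_new m i : ~ right_explored m (left_site m i).
Proof.
rewrite /right_explored /explored /left_site /= => -[[h _]|[j /= jm]].
  by clear - h; lia.
by rewrite /right_site; clear; lia.
Qed.

Lemma measurable_neg_log_rho : measurable_fun setT (fun x => - psi x).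
Proof. by apply: measurableT_comp => //; exact: measurable_log_rho. Qed.

Lemma neg_log_rho_le x : `|- psi x| <= C.
Proof. by rewrite normrN; exact: log_rho_le. Qed.

Lemma right_good_bpast m : bpast omega (right_explored m) (right_good m).
Proof.
apply: block_good_bpast; first exact: measurable_log_rho.
exact: log_rho_le.
Qed.

Lemma left_good_bpast m : bpast omega (explored m.+1) (left_good m).
Proof.
apply: bpast_sub (@explored_step m) _; apply: block_good_bpast.
  exact: measurable_neg_log_rho.
exact: neg_log_rho_le.
Qed.

Lemma right_explored_sub m : right_explored m `<=` explored m.+1.
Proof. by move=> z hz; apply: explored_step; left. Qed.

Lemma no_success_bpast M k : bpast omega (explored (M + k)) (no_success M k).
Proof.
elim: k => [|k IH] /=; first exact: bpast_cst.
rewrite addnS; apply: bpastM.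
  exact: bpast_sub (@explored_sub _) IH.
apply: bpastB; first exact: bpast_cst.
apply: bpastM; last exact: left_good_bpast.
exact: bpast_sub (@right_explored_sub _) (right_good_bpast _).
Qed.

Lemma wide_ge0 x : 0 <= wide C x.
Proof. by rewrite /wide mulr_ge0 ?expR_ge0 ?ler0n. Qed.

(** The right block is tested with weight [no_success], then the left block with this weight times
    [right_good]; the two factors [1 / 22] give [1 / 484]. *)
Lemma Ex_no_success M k : Ex P (no_success M k) <= (1 - 484^-1) ^+ k.
Proof.
have [_ indep _] := omega_iid.
have C4 := log_rho_bound_ge4 eps0_bounds; have s0 := variance_gt0.
elim: k => [|k IH]; first by rewrite expr0 /= Ex_cst.
set m := (M + k)%N; have [s1 s2 s3 s4 _] := scales (stage m).
have Fp := no_success_bpast M k; rewrite -/m in Fp.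
have h1 := Ex_block_good indep C4 s0 (measurable_log_rho eps0)
  (log_rho_le eps0_bounds) log_rho_mean log_rho_var
  (@right_site_inj m) (@right_new m) s1 (wide_ge0 _) s2 Fp (no_success_ge0 M k) s3.
have F1 : bpast omega (right_explored m) (fun w => no_success M k w * right_good m w).
  apply: bpastM; last exact: right_good_bpast.
  by apply: bpast_sub Fp; exact: sites_upto_sub.
have F1ge0 w : 0 <= no_success M k w * right_good m w.
  apply: mulr_ge0; first exact: no_success_ge0.
  by case: (good01 m w) => -[->|->].
have neg_mean j : Ex P (fun w => - psi (omega j w)) = 0.
  rewrite (_ : (fun w => _) = (fun w => - 1 * psi (omega j w))).
    rewrite (ExZ _ (log_rho_omega_bpast (D := [set: int]) I)) log_rho_mean mulr0 //.
  by apply/funext => w; rewrite mulN1r.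
have neg_var j : Ex P (fun w => (- psi (omega j w)) ^+ 2) = sigma2.
  by under eq_fun do rewrite sqrrN; exact: log_rho_var.
have h2 := Ex_block_good indep C4 s0 measurable_neg_log_rho
  neg_log_rho_le neg_mean neg_var
  (@left_site_inj m) (@left_new m) s1 (wide_ge0 _) s2 F1 F1ge0 s3.
have Fm := bpast_sub (@explored_sub m) Fp.
have F2 := bpastM (bpast_sub (@right_explored_sub m) F1) (left_good_bpast m).
have -> : Ex P (no_success M k.+1) = Ex P (no_success M k) -
    Ex P (fun w => no_success M k w * right_good m w * left_good m w).
  rewrite -(ExB Fm F2); congr (Ex P _); apply/funext => w /=.
  by rewrite -/m; ring.
have := h1; have := h2; rewrite exprS -/(right_good m) -/(left_good m); lra.
Qed.

(** For fixed [M], the absence of success from stage [M] on has probability at most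
    [(1 - 1 / 484) ^ k] for every [k], hence zero; there are countably many [M]. *)
Lemma success_infinitely_often :
  {ae P, forall w, forall M : nat, exists2 m : nat, (M <= m)%N &
    right_good m w = 1 /\ left_good m w = 1}.
Proof.
apply: ae_foralln => M.
pose E k := no_success M k @^-1` `[1, +oo[%classic.
have mE k : measurable (E k).
  have := bpast_measurable (no_success_bpast M k) measurableT.
  by move=> /(_ `[1, +oo[%classic (measurable_itv _)); rewrite setTI.
have PE k : (P (E k) <= ((1 - 484^-1) ^+ k : R)%:E)%E.
  apply: (@le_trans _ _ (Ex P (no_success M k))%:E); last first.
    by rewrite lee_fin; exact: Ex_no_success.
  rewrite /Ex /Rintegral fineK; last first.
    exact: integrable_fin_num (bpast_integrable (no_success_bpast M k)).
  rewrite -[X in P X](setIT (E k)) -integral_indic//.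
  apply: ge0_le_integral => //.
  - by apply/measurable_EFinP; exact: measurable_indic.
  - by apply/measurable_EFinP; exact: bpast_measurable (no_success_bpast M k).
  move=> w _; rewrite lee_fin indicE; case: (boolP (w \in E k)) => [|_].
    by rewrite inE /E /= in_itv /= andbT.
  exact: no_success_ge0.
exists (\bigcap_k E k); split.
- by apply: bigcap_measurable; [exists 0%N|].
- have mEE : measurable (\bigcap_k E k).
    by apply: bigcap_measurable; [exists 0%N|].
  have pfin : P (\bigcap_k E k) \is a fin_num by exact: fin_num_measure.
  have le k : fine (P (\bigcap_k E k)) <= (1 - 484^-1) ^+ k.
    rewrite -lee_fin fineK//; apply: le_trans (PE k).
    by apply: le_measure; rewrite ?inE//; exact: bigcap_inf.
  have q1 : `|1 - 484^-1 : R| < 1 by rewrite ger0_norm; lra.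
  have lim0 := cvg_expr q1.
  have : fine (P (\bigcap_k E k)) <= 0.
    rewrite -(cvg_lim _ lim0)//; apply: limr_ge; first exact: (cvgP _ lim0).
    by apply: nearW => k; exact: le.
  rewrite -lee_fin fineK// => h.
  by apply/eqP; rewrite eq_le measure_ge0 andbT; exact: h.
move=> w /= nw k _; rewrite /E /= in_itv /= andbT.
elim: k => [|k IH] //=.
have -> : right_good (M + k) w * left_good (M + k) w = 0.
  case: (good01 (M + k) w) => -[->|r1] [->|l1]; rewrite ?mul0r ?mulr0//.
  by case: nw; exists (M + k)%N; rewrite ?leq_addr.
by rewrite subr0 mulr1.
Qed.

End stages.

End environment.

Theorem proposition1p5 (R : realType) (d : measure_display)
    (Omega : measurableType d) (P : probability Omega R)
    (omega : int -> {RV P >-> R})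
    (omega_iid : iid_environment omega)
    (eps0 : R) (eps0_bounds : 0 < eps0 < 1 / 2)
    (elliptic : P [set w | eps0 <= omega 0 w <= 1 - eps0] = 1%E)
    (recurrent : ('E_P[fun w => (ln (rho (omega 0 w)))%R] = 0)%E)
    (nondegenerate : (0 < 'E_P[fun w => (ln (rho (omega 0 w)) ^+ 2)%R])%E)
    (r : nat) (r_gt1 : (1 < r)%N) :
  {ae P, forall w, exists2 c : R, 0 < c &
    forall y : 'I_r -> int,
      (forall j, (2 %| y j)%Z) \/ (forall j, ~~ (2 %| y j)%Z) ->
    forall (d' : measure_display) (T : measurableType d')
      (Q : probability T R) (Z : 'I_r -> nat -> {RV Q >-> int}),
      independent_walks (fun x => omega x w) y Z ->
    (c%:E <= limn_esup (fun N : nat =>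
      ((ln N%:R)^-1)%:E * \sum_(1 <= n < N.+1) (n%:R^-1)%:E *
        (\esum_(k in [set: int]) \prod_(j < r) Q [set t | Z j n t = k])))%E}.
Proof.
have C4 := log_rho_bound_ge4 eps0_bounds.
have s0 := variance_gt0 omega_iid eps0_bounds elliptic nondegenerate.
have K1 := mass_ratio_ge1 omega_iid eps0_bounds elliptic nondegenerate.
have /andP[e0 e12] := eps0_bounds; have e1 : eps0 < 1 by lra.
(* The next scale is a function of the extent already explored, not of the environment. *)
have [nn /choice [hh scales]] := choice (scale_exists C4 s0 K1 e0).
have io := success_infinitely_often omega_iid eps0_bounds elliptic recurrent
  nondegenerate scales.
have ell : {ae P, forall w, forall n : nat,
    (eps0 <= omega n%:Z w <= 1 - eps0) && (eps0 <= omega (- n%:Z) w <= 1 - eps0)}.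
  apply: ae_foralln => n.
  have h1 := elliptic_ae omega_iid elliptic n%:Z.
  have h2 := elliptic_ae omega_iid elliptic (- n%:Z).
  by apply: filterS2 h1 h2 => w h1 h2; rewrite h1 h2.
apply: filterS2 io ell => w io ell.
have ew x : eps0 <= omega x w <= 1 - eps0.
  case: (lerP 0 x) => x0.
    by have /andP[+ _] := ell (absz x); have -> : (absz x)%:Z = x by lia.
  by have /andP[_ +] := ell (absz x); have -> : - (absz x)%:Z = x by lia.
have r0 : (0 < r)%N by exact: ltnW.
set K := mass_ratio omega eps0 in K1 scales.
have K8 : 0 < 8 * K by lra.
(* This constant is deterministic: [K] depends only on the law of the environment and on [eps0]. *)
exists ((eps0 ^+ 2 / (8 * K)) ^+ r / 6).
  by rewrite divr_gt0// exprn_gt0// divr_gt0// exprn_gt0.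
move=> y par d' T Q Z [walk _].
apply: limn_esup_ge => M.
pose Y := \max_(j < r) absz (y j).
(* [m > Y] places all starting points in the explored interval with one site to spare, and [m >= M]
   will give [N >= M]. *)
have [m Mm [rg lg]] := io (maxn M Y.+1).
have := stage_ge scales m; set X := stage nn m => mX.
have ewl x : eps0 <= omega x w by have /andP[] := ew x.
have ewr x : omega x w <= 1 - eps0 by have /andP[] := ew x.
have psiE x : log_rho eps0 (omega x w) = ln ((1 - omega x w) / omega x w).
  exact: log_rhoE.
have xi_le x : `|ln ((1 - omega x w) / omega x w)| <= log_rho_bound eps0.
  by rewrite -psiE; exact: log_rho_le.
have goodE psi s h s1 n : block_good omega (log_rho_bound eps0) (variance omega eps0)
     psi s h s1 n w = 1 ->
   10 * h <= vpos (vrun h s1 (fun i => psi (omega (s i) w)) n) /\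
   vsum (vrun h s1 (fun i => psi (omega (s i) w)) n) <=
     good_sum (log_rho_bound eps0) (variance omega eps0).
  rewrite /block_good; case: ifP => [/andP[]//|_ /esym/eqP].
  by rewrite oner_eq0.
have [gr1 gr2] := goodE _ _ _ _ _ rg; have [gl1 gl2] := goodE _ _ _ _ _ lg.
have rE : (fun i => log_rho eps0 (omega (right_site nn m i) w)) =
    (fun k : nat => ln ((1 - omega (X%:Z + k.+1%:Z) w) / omega (X%:Z + k.+1%:Z) w)).
  by apply/funext => i; rewrite psiE.
have lE : (fun i => - log_rho eps0 (omega (left_site nn m i) w)) =
    (fun k : nat => - ln ((1 - omega (- X%:Z - k%:Z) w) / omega (- X%:Z - k%:Z) w)).
  by apply/funext => i; rewrite psiE.
rewrite rE in gr1 gr2; rewrite lE in gl1 gl2.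
have [b [n1 [N [[n10 n1N N1 XN] [lnN low]]]]] :=
  @meeting_window R _ _ K eps0 C4 K1 e0 e1 (fun x => omega x w) _ ewl ewr xi_le erefl
  X _ _ (scales X) gr1 gr2 gl1 gl2.
exists N.
  move: Mm; rewrite geq_max => /andP[Mm _].
  exact: leq_trans Mm (leq_trans mX XN).
apply: (@meetings_lower R (fun x => omega x w) eps0 K b n1 N X r) => //.
- by move=> x; apply: le_trans (ewl x); exact: ltW.
- by move=> x; apply: le_trans (ewr x) _; rewrite gerBl ltW.
- exact: par.
move=> j.
have : (absz (y j) <= Y)%N by apply: (leq_bigmax j).
move: Mm; rewrite geq_max => /andP[_ Ym] yY.
by split; clear - yY Ym mX; lia.
Qed.
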